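(* If $\pi\geq 2$ and $g\geq 1$ then $\mathcal{C}h_{\pi}^{g}=\mathcal{C}h_{\pi}^{\pi-g}$, where $\mathcal{C}h_{\pi}^{h}$ denotes the family of smooth hyperelliptic curves of genus $\pi$ with an involution over a curve of genus $h$.
   Context: Curves are smooth, irreducible and projective. A hyperelliptic curve is a curve of genus at least $2$ admitting a $2:1$ morphism to $\mathbf{P}^1$. A curve $C$ has an involution over a curve $X$ if there is a double cover (a $2:1$ morphism) $C\to X$; equivalently there is an automorphism $\sigma$ of $C$ of order $2$ with $C/\sigma\cong X$. The family $\mathcal{C}h_{\pi}^{h}$ is the set of isomorphism classes of smooth hyperelliptic curves of genus $\pi$ having an involution over some smooth curve of genus $h$, a subset of the moduli space $\mathcal{M}_\pi$ of smooth curves of genus $\pi$.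
   Formalization: The case g = π is excluded, since there the claim fails: every hyperelliptic curve of genus π covers a curve of genus 0 doubly, but by Riemann–Hurwitz none covers a curve of genus π ≥ 2; the base field is taken algebraically closed of characteristic 0. *)

(* Defs.v *)
From HB Require Import structures.
From mathcomp Require Import all_boot all_order all_algebra.
From mathcomp Require Import fraction generic_quotient.
From mathcomp Require Import mpoly.

Set Implicit Arguments.
Unset Strict Implicit.
Unset Printing Implicit Defensive.

Import GRing.Theory.
Local Open Scope ring_scope.

(* Curves over an algebraically closed field k, in the classical (Weil) style. *)
(* An irreducible projective variety V in P^n is given by its function field K *)
(* and its generic point (f_0 : ... : f_n) in P^n(K): its homogeneous ideal is *)
(* the prime ideal of all forms F with F(f) = 0, and K consists of the         *)
(* restrictions to V of the quotients F/G of forms of the same degree.         *)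
Record pvariety (k : closedFieldType) := PVariety {
  pdim : nat;
  ffield : fieldType;
  cst : {rmorphism k -> ffield};
  gpt : 'I_pdim.+1 -> ffield;
  gpt_neq0 : exists i, gpt i != 0;
  ffield_gen : forall z : ffield,
    exists (d : nat) (F G : {mpoly k[pdim.+1]}),
      [/\ F \is d.-homog, G \is d.-homog,
          mmap cst gpt G != 0 & z = mmap cst gpt F / mmap cst gpt G]
}.

Section Variety.
Variables (k : closedFieldType) (V : pvariety k).
Local Notation K := (ffield V).
Local Notation n := (pdim V).

(* The common zeros in P^n(k) of the homogeneous ideal of V. *)
Definition on_variety (p : 'I_n.+1 -> k) : Prop :=
  (exists i, p i != 0) /\
  (forall (d : nat) (F : {mpoly k[n.+1]}),
     F \is d.-homog -> mmap (cst V) (@gpt k V) F = 0 -> F.@[p] = 0).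

(* Homogeneous coordinate vectors; proportional vectors are the same point of  *)
(* P^n, and all the notions below depend only on that point.                   *)
Record point := Point { pcoord :> 'I_n.+1 -> k; pointP : on_variety pcoord }.

(* The rational function z is regular at p and takes the value c there. *)
Definition has_value (p : point) (z : K) (c : k) : Prop :=
  exists (d : nat) (F G : {mpoly k[n.+1]}),
    [/\ F \is d.-homog, G \is d.-homog, G.@[p] != 0,
        z = mmap (cst V) (@gpt k V) F / mmap (cst V) (@gpt k V) G
      & c = F.@[p] / G.@[p]].

Definition regular_at (p : point) (z : K) : Prop := exists c, has_value p z c.

(* dim V = 1: the function field has transcendence degree 1 over k. *)
Definition one_dimensional : Prop :=
  exists x : K,
    (forall P : {poly k}, root (map_poly (cst V) P) x -> P = 0) /\
    (forall z : K, exists2 P : {poly {poly k}}, P != 0 &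
       root (map_poly (fun q : {poly k} => (map_poly (cst V) q).[x]) P) z).

(* p is a nonsingular point of the curve V: its local ring is a discrete       *)
(* valuation ring, with uniformizer t; units are the functions with nonzero    *)
(* value at p.                                                                 *)
Definition nonsingular_at (p : point) : Prop :=
  exists t : K,
    [/\ t != 0, has_value p t 0
      & forall z : K, z != 0 ->
          exists (m : int) (c : k), c != 0 /\ has_value p (z / t ^ m) c].

Record derivation := Derivation {
  der :> K -> K;
  derD : forall a b, der (a + b) = der a + der b;
  derM : forall a b, der (a * b) = a * der b + b * der a;
  der_cst : forall c : k, der (cst V c) = 0
}.

(* Rational differential forms on the curve V, as functions on Der_k(K, K):    *)
(* Omega_(K/k) is finite dimensional over K with dual Der_k(K, K), and g dh is *)
(* the form D |-> g * D h. A form is regular at p when it is in the image of   *)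
(* Omega_(O_p/k), i.e., is a sum of g_i dh_i with all g_i, h_i regular at p.   *)
Definition form := derivation -> K.

Definition form_regular_at (w : form) (p : point) : Prop :=
  exists (m : nat) (g h : 'I_m -> K),
    [/\ forall i, regular_at p (g i), forall i, regular_at p (h i)
      & forall D : derivation, w D = \sum_i g i * D (h i)].

Definition regular_form (w : form) : Prop := forall p, form_regular_at w p.

(* Meaningful for smooth curves: h = dim_k H^0(V, Omega). The integer h may be *)
(* negative, in which case no curve has genus h.                               *)
Definition has_genus (h : int) : Prop :=
  exists (m : nat) (w : 'I_m -> form),
    [/\ h = m%:Z, forall i, regular_form (w i)
      & forall v : form, regular_form v ->
          exists! a : 'rV[k]_m,
            forall D, v D = \sum_i cst V (a 0 i) * w i D].

End Variety.

Record curve (k : closedFieldType) := Curve {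
  curve_variety :> pvariety k;
  curve_dim1 : one_dimensional curve_variety;
  curve_smooth : forall p : point curve_variety, nonsingular_at p
}.

(* A nonconstant morphism of curves: a map on points together with the         *)
(* pull-back of rational functions, z |-> z \o phi.                            *)
Record morphism (k : closedFieldType) (C X : curve k) := Morphism {
  on_points :> point C -> point X;
  pullback : {rmorphism ffield X -> ffield C};
  pullback_cst : forall c : k, pullback (cst X c) = cst C c;
  pullbackP : forall (p : point C) (z : ffield X) (c : k),
    has_value (on_points p) z c -> has_value p (pullback z) c
}.

(* deg phi = d, that is [k(C) : phi^* k(X)] = d *)
Definition has_degree (k : closedFieldType) (C X : curve k)
    (phi : morphism C X) (d : nat) : Prop :=
  exists b : 'I_d -> ffield C,
    forall z : ffield C, exists! a : 'rV[ffield X]_d,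
      z = \sum_i pullback phi (a 0 i) * b i.

Definition double_cover (k : closedFieldType) (C X : curve k) : Prop :=
  exists phi : morphism C X, has_degree phi 2.

Definition proj_eq (k : closedFieldType) (n : nat) (p q : 'I_n -> k) : Prop :=
  exists c : k, c != 0 /\ forall i, q i = c * p i.

Definition isomorphic (k : closedFieldType) (C D : curve k) : Prop :=
  exists (phi : morphism C D) (psi : morphism D C),
    [/\ forall p : point C, proj_eq p (psi (phi p)),
        forall q : point D, proj_eq q (phi (psi q)),
        cancel (pullback phi) (pullback psi)
      & cancel (pullback psi) (pullback phi)].

(* The projective line: function field k(t), generic point (1 : t). *)
Section ProjectiveLine.
Variable k : closedFieldType.
Local Notation kt := {fraction {poly k}}.
Local Notation fr := (@FracField.tofrac {poly k}).

Definition P1_cst : {rmorphism k -> kt} := fr \o polyC.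
Definition P1_gpt (i : 'I_2) : kt := if i == ord0 then 1 else fr 'X.

Definition P1_form (d : nat) (A : {poly k}) : {mpoly k[2]} :=
  \sum_(i < d.+1) A`_i *: ('X_ord0 ^+ (d - i) * 'X_ord_max ^+ i).

Lemma P1_formP d A : P1_form d A \is d.-homog.
Proof.
apply: rpred_sum => i _; apply: dhomogZ.
have hX (j : 'I_2) e : ('X_j : {mpoly k[2]}) ^+ e \is e.-homog.
  rewrite -[X in X.-homog]mul1n; apply: dhomogMn.
  by rewrite dhomogX; apply/eqP; exact: mdeg1.
by have := dhomogM (hX ord0 (d - i)%N) (hX ord_max i); rewrite subnK // -ltnS.
Qed.

Lemma P1_form_gpt d (A : {poly k}) :
  (size A <= d.+1)%N -> mmap P1_cst P1_gpt (P1_form d A) = fr A.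
Proof.
move=> sA; rewrite raddf_sum /=.
transitivity (\sum_(i < d.+1) fr (A`_i *: 'X^i)).
  apply: eq_bigr => i _; rewrite mmapZ rmorphM !rmorphXn /= !mmapX !mmap1U.
  by rewrite /P1_gpt eqxx /= expr1n mul1r -mul_polyC rmorphM rmorphXn.
rewrite -raddf_sum -poly_def; congr (fr _); apply/polyP=> i.
by rewrite coef_poly; case: ltnP => // le; rewrite nth_default // (leq_trans sA).
Qed.

Lemma P1_form_eval d (A : {poly k}) (p : 'I_2 -> k) :
  (P1_form d A).@[p] = \sum_(i < d.+1) A`_i * (p ord0 ^+ (d - i) * p ord_max ^+ i).
Proof.
rewrite raddf_sum; apply: eq_bigr => i _ /=.
by rewrite mevalZ rmorphM !rmorphXn /= !mevalXU.
Qed.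

Lemma P1_form_eval0 d (A : {poly k}) (p : 'I_2 -> k) :
  p ord0 = 0 -> (P1_form d A).@[p] = A`_d * p ord_max ^+ d.
Proof.
move=> p0; rewrite P1_form_eval big_ord_recr /= subnn expr0 mul1r big1 ?add0r //.
by move=> i _; rewrite p0 expr0n subn_eq0 leqNgt ltn_ord /= mul0r mulr0.
Qed.

Lemma P1_form_evalN0 d (A : {poly k}) (p : 'I_2 -> k) :
  (size A <= d.+1)%N -> p ord0 != 0 ->
  (P1_form d A).@[p] = p ord0 ^+ d * A.[p ord_max / p ord0].
Proof.
move=> sA p0; rewrite P1_form_eval (horner_coef_wide _ sA) mulr_sumr.
apply: eq_bigr => i _; rewrite [RHS]mulrCA; congr (_ * _).
rewrite expr_div_n mulrCA [LHS]mulrC; congr (_ * _).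
have -> : p ord0 ^+ d = p ord0 ^+ (d - i) * p ord0 ^+ i.
  by rewrite -exprD subnK // -ltnS.
by rewrite mulfK // expf_neq0.
Qed.

Lemma fraction_polyP (z : kt) : exists A B : {poly k}, B != 0 /\ z = fr A / fr B.
Proof.
elim/quotW: z => r.
exists (frac r).1, (frac r).2; split; first exact: denom_ratioP.
apply: canRL (mulfK _) _; first by rewrite tofrac_eq0 denom_ratioP.
have E (x : {poly k}) : fr x = \pi_({fraction {poly k}})%qT (Ratio x 1).
  by unlock FracField.tofrac.
rewrite !E -[LHS]FracField.pi_mul; apply/eqmodP.
rewrite /= FracField.equivfE /FracField.mulf.
by rewrite !numden_Ratio ?mulr1 ?mulf_neq0 ?oner_neq0 ?denom_ratioP // mulrC.
Qed.

Lemma P1_gpt_neq0 : exists i, P1_gpt i != 0.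
Proof. by exists ord0; rewrite /P1_gpt eqxx oner_neq0. Qed.

Lemma P1_ffield_gen (z : kt) : exists (d : nat) (F G : {mpoly k[2]}),
  [/\ F \is d.-homog, G \is d.-homog, mmap P1_cst P1_gpt G != 0
    & z = mmap P1_cst P1_gpt F / mmap P1_cst P1_gpt G].
Proof.
have [A [B [B0 ->]]] := fraction_polyP z.
exists (size A + size B)%N, (P1_form (size A + size B) A),
  (P1_form (size A + size B) B).
have sA : (size A <= (size A + size B).+1)%N by rewrite leqW // leq_addr.
have sB : (size B <= (size A + size B).+1)%N by rewrite leqW // leq_addl.
by split; rewrite ?P1_formP ?P1_form_gpt ?tofrac_eq0.
Qed.

Definition P1_variety : pvariety k := PVariety P1_gpt_neq0 P1_ffield_gen.

Lemma P1_has_value (p : point P1_variety) d (A B : {poly k}) :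
  (size A <= d.+1)%N -> (size B <= d.+1)%N -> (P1_form d B).@[p] != 0 ->
  has_value p (fr A / fr B) ((P1_form d A).@[p] / (P1_form d B).@[p]).
Proof.
move=> sA sB B0; exists d, (P1_form d A), (P1_form d B).
by split; rewrite ?P1_formP //= !P1_form_gpt.
Qed.

Lemma P1_dim1 : one_dimensional P1_variety.
Proof.
have evX (q : {poly k}) : (map_poly P1_cst q).[fr 'X] = fr q.
  by rewrite -[q in RHS]comp_polyXr -horner_map /= -map_poly_comp.
exists (fr 'X); split => [P|z].
  by rewrite /root evX tofrac_eq0 => /eqP.
have [A [B [B0 ->]]] := fraction_polyP z.
exists (B *: 'X - A%:P).
  apply/negP => /eqP /(congr1 (fun P : {poly {poly k}} => P`_1)) /eqP.
  by rewrite coefB coefZ coefX coefC /= mulr1 subr0 coef0 (negPf B0).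
rewrite (eq_map_poly (g := fr)) // rmorphB /= map_polyZ map_polyX map_polyC /=.
rewrite rootE hornerD hornerN hornerZ hornerX hornerC.
by rewrite mulrC divfK ?subrr ?tofrac_eq0.
Qed.

Lemma P1_smooth (p : point P1_variety) : nonsingular_at p.
Proof.
have [p0|p0] := eqVneq (p ord0) 0.
  have p1 : p ord_max != 0.
    have [[i pi0] _] := pointP p; apply: contraNneq pi0 => p1.
    apply/eqP; case: i => -[|[|//]] lt.
      by apply: etrans p0; congr (p _); apply: val_inj.
    by apply: etrans p1; congr (p _); apply: val_inj.
  have v (A B : {poly k}) d : (size A <= d.+1)%N -> size B = d.+1 ->
      has_value p (fr A / fr B) (A`_d / B`_d).
    move=> sA sB; have B0 : B`_d != 0.
      by have := lead_coefE B; rewrite sB /= => <-;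
        rewrite lead_coef_eq0 -size_poly_eq0 sB.
    have := @P1_has_value p d A B sA; rewrite sB leqnn !P1_form_eval0 //.
    by rewrite -mulf_div divff ?expf_neq0 // mulr1 mulf_neq0 ?expf_neq0 //; exact.
  exists ((fr 'X)^-1); split.
  - by rewrite invr_eq0 tofrac_eq0 polyX_eq0.
  - have := v 1 'X 1%N; rewrite size_poly1 size_polyX coef1 coefX divr1 rmorph1.
    by rewrite mul1r; exact.
  move=> z; have [A [B [B0 ->]]] := fraction_polyP z.
  rewrite mulf_eq0 invr_eq0 !tofrac_eq0 (negPf B0) orbF => A0.
  have a0 : (0 < size A)%N by rewrite size_poly_gt0.
  have b0 : (0 < size B)%N by rewrite size_poly_gt0.
  exists ((size B)%:Z - (size A)%:Z), (lead_coef A / lead_coef B); split.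
    by rewrite mulf_neq0 ?invr_eq0 ?lead_coef_eq0.
  have X0 : fr 'X != 0 by rewrite tofrac_eq0 polyX_eq0.
  have -> : fr A / fr B / (fr 'X)^-1 ^ ((size B)%:Z - (size A)%:Z) =
      fr (A * 'X^(size B)) / fr (B * 'X^(size A)).
    rewrite expfzDr ?invr_eq0 // -exprnP -exprnN !exprVn invrK.
    by rewrite invfM invrK mulf_div !rmorphM !rmorphXn.
  set d := (size A + size B).-1.
  have dE : d.+1 = (size A + size B)%N by rewrite prednK // addn_gt0 a0.
  have cA : (A * 'X^(size B))`_d = lead_coef A.
    rewrite -(lead_coef_Mmonic A (monicXn _ (size B))) lead_coefE.
    by rewrite size_mulXn // addnC.
  have cB : (B * 'X^(size A))`_d = lead_coef B.
    rewrite -(lead_coef_Mmonic B (monicXn _ (size A))) lead_coefE.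
    by rewrite size_mulXn.
  have := v (A * 'X^(size B)) (B * 'X^(size A)) d.
  rewrite cA cB !size_mulXn // dE; apply => //.
  by rewrite addnC.
set a := p ord_max / p ord0.
have v (A B : {poly k}) : B.[a] != 0 ->
    has_value p (fr A / fr B) (A.[a] / B.[a]).
  move=> Ba; set d := (size A + size B)%N.
  have sA : (size A <= d.+1)%N by rewrite leqW // leq_addr.
  have sB : (size B <= d.+1)%N by rewrite leqW // leq_addl.
  have := @P1_has_value p d A B sA sB; rewrite !P1_form_evalN0 // -/a.
  rewrite -mulf_div divff ?expf_neq0 // mul1r; apply.
  by rewrite mulf_neq0 ?expf_neq0.
clearbody a.
have t0 : fr ('X - a%:P) != 0 by rewrite tofrac_eq0 polyXsubC_eq0.
exists (fr ('X - a%:P)); split => // [|z].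
  have := v ('X - a%:P) 1; rewrite !hornerE subrr mul0r rmorph1 divr1.
  by apply; rewrite oner_neq0.
have [A [B [B0 ->]]] := fraction_polyP z.
rewrite mulf_eq0 invr_eq0 !tofrac_eq0 (negPf B0) orbF => A0.
have [m [A' [/implyP/(_ A0) A'a AE]]] := multiplicity_XsubC A a.
have [l [B' [/implyP/(_ B0) B'a BE]]] := multiplicity_XsubC B a.
exists (m%:Z - l%:Z), (A'.[a] / B'.[a]); split.
  by rewrite mulf_neq0 ?invr_eq0.
suff -> : fr A / fr B / fr ('X - a%:P) ^ (m%:Z - l%:Z) = fr A' / fr B' by exact: v.
rewrite expfzDr // -exprnP -exprnN {1}AE {1}BE !tofracM !tofracXn.
set t := fr _ in t0 *.
apply: (canLR (mulfK _)); first by rewrite mulf_neq0 ?invr_eq0 ?expf_neq0.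
by rewrite mulf_div.
Qed.

Definition P1 : curve k := Curve P1_dim1 P1_smooth.

End ProjectiveLine.

Section Families.
Variable k : closedFieldType.

Definition hyperelliptic (C : curve k) : Prop :=
  (exists2 h : int, 2 <= h & has_genus C h) /\ double_cover C (P1 k).

Definition has_involution_over_genus (C : curve k) (h : int) : Prop :=
  exists X : curve k, double_cover C X /\ has_genus X h.

Definition iso_class (C : curve k) : curve k -> Prop := isomorphic C.

Definition Ch (pi h : int) : (curve k -> Prop) -> Prop := fun c =>
  exists C : curve k,
    [/\ c = iso_class C, hyperelliptic C, has_genus C pi
      & has_involution_over_genus C h].

End Families.

Arguments Ch : clear implicits.

(* Main.v *)
(* A hyperelliptic curve C of genus pi >= 2 is y^2 = Q(x) with Q squarefree,   *)
(* and its regular forms are R(x) dx / y with deg R < pi. Hence pi is read off *)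
(* deg Q, and an involution s of C acts on x through the ratios of regular     *)
(* forms, that is, by a Moebius transformation. If s is not the hyperelliptic  *)
(* involution i, one may change x so that s x = - x; then s y = y or s y = - y *)
(* and Q(x) = S(x^2). The quotients of C by s and by s i have function fields  *)
(* k(x^2, y) and k(x^2, x y) in some order, with equations y^2 = S(u) and      *)
(* (x y)^2 = u S(u) for u = x^2, and the genera of these two curves add up to  *)
(* pi. If s = i, the quotient is rational. Thus for h >= 1 an involution with  *)
(* quotient of genus h yields one with quotient of genus pi - h.               *)

Require Import Defs.
From HB Require Import structures.
From mathcomp Require Import all_boot all_order all_algebra.
From mathcomp Require Import mpoly zify ring.
From Stdlib Require Import Classical ClassicalEpsilon.
From Stdlib Require Import FunctionalExtensionality PropExtensionality.

Set Implicit Arguments.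
Unset Strict Implicit.
Unset Printing Implicit Defensive.

Import Order.TTheory GRing.Theory Num.Theory.
Local Open Scope ring_scope.

(** * Values of rational functions *)

(** A double cover C -> X is an involution [s] of C, and composing [s] with the hyperelliptic
    involution exchanges a quotient of genus g with one of genus pi - g. [complementary_involution]
    is this exchange in one direction; applied to g and to pi - g it gives both inclusions, with the
    same curve C.

    Everything is computed in function fields. [P1_quadratic_field] writes the function field of a
    hyperelliptic curve as a [quadratic_field]: k(x, y) with y^2 = Q(x) and Q squarefree. An
    embedding of function fields of smooth curves comes from a morphism ([morphism_of_embedding]),
    so regular forms depend only on the field and can be computed on an explicit projective model
    covered by two affine charts. With m = (size Q)./2 they are the R(x) dx / y with deg R <= m - 2
    ([curve_regular_formP]), and the genus is m - 1 ([quad_genus], [quad_genus_unique]).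

    The cover yields [s] with fixed field k(X) ([degree2_generator], [quadratic_involution]). As [s]
    preserves regular forms, it acts on x by a Moebius transformation ([automorphism_moebius]),
    which [moebius_involution] normalises to s x = x or s x = - x. In the first case the quotient is
    rational, which a positive genus excludes. In the second, [involution_y] gives s y = y or s y =
    - y, hence Q = S(x^2); the two quotients are v^2 = S(u) and v^2 = u S(u), and their genera, read
    off the degrees, add up to pi. *)

Section Mmap.
Variables (k : comNzRingType) (n : nat).

(** Evaluating a polynomial uses only constants, sums and products, so a relation closed under these
    passes to the values. It is applied to graphs of morphisms, to [has_value], to equality and to
    membership in k[x, y]. *)
Lemma mmap_rel (L1 L2 : comNzRingType) (c1 : {rmorphism k -> L1})
    (c2 : {rmorphism k -> L2}) (z1 : 'I_n -> L1) (z2 : 'I_n -> L2)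
    (P : L1 -> L2 -> Prop) :
  (forall a, P (c1 a) (c2 a)) ->
  (forall u u' v v', P u u' -> P v v' -> P (u + v) (u' + v')) ->
  (forall u u' v v', P u u' -> P v v' -> P (u * v) (u' * v')) ->
  (forall i, P (z1 i) (z2 i)) ->
  forall F, P (mmap c1 z1 F) (mmap c2 z2 F).
Proof.
move=> Pc PD PM Pz; elim/mpolyind => [|a m F _ _ IH].
  by rewrite !raddf0; have := Pc 0; rewrite !rmorph0.
rewrite !raddfD /= !mmapZ !mmapX; apply: (PD) => //; apply: (PM) => //.
rewrite /mmap1; apply: (big_rec2 P) => [|i u v _ h].
  by have := Pc 1; rewrite !rmorph1.
apply: (PM) => //; elim: (m i) => [|e IHe].
  by rewrite !expr0; have := Pc 1; rewrite !rmorph1.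
by rewrite !exprS; apply: PM.
Qed.

Lemma mmap_scale (L : comNzRingType) (c : {rmorphism k -> L}) (z : 'I_n -> L)
    (a : L) d (F : {mpoly k[n]}) :
  F \is d.-homog -> mmap c (fun i => a * z i) F = a ^+ d * mmap c z F.
Proof.
move=> /dhomogP hF; rewrite /mmap mulr_sumr [LHS]big_seq [RHS]big_seq.
apply: eq_bigr => m /hF <-; rewrite mulrCA; congr (_ * _).
rewrite /mmap1 (eq_bigr _ (fun i _ => exprMn (m i) a (z i))) big_split /=.
by congr (_ * _); rewrite mdegE prodrXr.
Qed.

End Mmap.

Lemma mmap_rmorph (k L1 L2 : comNzRingType) n (c : {rmorphism k -> L1})
    (f : {rmorphism L1 -> L2}) (z : 'I_n -> L1) (F : {mpoly k[n]}) :
  f (mmap c z F) = mmap (f \o c) (f \o z) F.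
Proof.
apply: (@mmap_rel _ _ _ _ c (f \o c) z (f \o z) (fun u v => f u = v)) => //.
  by move=> u _ v _ <- <-; rewrite rmorphD.
by move=> u _ v _ <- <-; rewrite rmorphM.
Qed.

(* The pairs of values taken by a quotient of two forms of the same degree     *)
(* under two evaluations: for two copies of a generic point this describes the *)
(* function field, for a generic point and a point it describes has_value.     *)
Section Ratio.
Variables (k : closedFieldType) (n : nat) (L1 L2 : fieldType).
Variables (c1 : {rmorphism k -> L1}) (c2 : {rmorphism k -> L2}).
Variables (v1 : 'I_n -> L1) (v2 : 'I_n -> L2).

Definition ratio (z : L1) (w : L2) : Prop :=
  exists d (F G : {mpoly k[n]}),
    [/\ F \is d.-homog /\ G \is d.-homog, mmap c1 v1 G != 0, mmap c2 v2 G != 0,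
        z = mmap c1 v1 F / mmap c1 v1 G & w = mmap c2 v2 F / mmap c2 v2 G].

Lemma ratioD z w z' w' : ratio z w -> ratio z' w' -> ratio (z + z') (w + w').
Proof.
move=> [d [F [G [[hF hG] G1 G2 -> ->]]]] [e [F' [G' [[hF' hG'] G1' G2' -> ->]]]].
exists (d + e)%N, (F * G' + F' * G), (G * G'); split.
- split; last exact: dhomogM.
  by apply: rpredD; [exact: dhomogM | rewrite addnC; exact: dhomogM].
- by rewrite rmorphM mulf_neq0.
- by rewrite rmorphM mulf_neq0.
- by rewrite rmorphD !rmorphM /= addf_div.
- by rewrite rmorphD !rmorphM /= addf_div.
Qed.

Lemma ratioM z w z' w' : ratio z w -> ratio z' w' -> ratio (z * z') (w * w').
Proof.
move=> [d [F [G [[hF hG] G1 G2 -> ->]]]] [e [F' [G' [[hF' hG'] G1' G2' -> ->]]]].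
exists (d + e)%N, (F * F'), (G * G'); split.
- by split; exact: dhomogM.
- by rewrite rmorphM mulf_neq0.
- by rewrite rmorphM mulf_neq0.
- by rewrite !rmorphM /= mulf_div.
- by rewrite !rmorphM /= mulf_div.
Qed.

Lemma ratioV z w : ratio z w -> z != 0 -> w != 0 -> ratio z^-1 w^-1.
Proof.
move=> [d [F [G [[hF hG] G1 G2 -> ->]]]].
rewrite !mulf_eq0 !invr_eq0 !negb_or => /andP[F1 _] /andP[F2 _].
by exists d, G, F; split; rewrite ?invf_div.
Qed.

Lemma ratio_cst a : ratio (c1 a) (c2 a).
Proof.
exists 0%N, (a *: 1), 1; rewrite !mmapZ !(rmorph1 (mmap _ _)) !mulr1 !divr1.
by rewrite !oner_neq0; split=> //; split; [apply: dhomogZ|]; exact: dhomog1.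
Qed.

Lemma ratio_coord i j :
  v1 j != 0 -> v2 j != 0 -> ratio (v1 i / v1 j) (v2 i / v2 j).
Proof.
move=> j1 j2; exists 1%N, 'X_i, 'X_j; rewrite !mmapX !mmap1U; split=> //.
by split; rewrite dhomogX; apply/eqP/mdeg1.
Qed.

End Ratio.

Section Values.
Variables (k : closedFieldType) (V : pvariety k) (p : point V).
Local Notation K := (ffield V).

Lemma on_variety_neq0 d (F : {mpoly k[(pdim V).+1]}) :
  F \is d.-homog -> F.@[p] != 0 -> mmap (cst V) (gpt (p := V)) F != 0.
Proof.
move=> hF; apply: contraNneq => F0; apply/eqP; case: (pointP p) => _ h.
exact: h hF F0.
Qed.

Lemma has_valueE z c :
  has_value p z c <-> ratio (cst V) (@idfun k) (gpt (p := V)) p z c.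
Proof.
split=> [[d [F [G [hF hG G0 -> ->]]]]|[d [F [G [[hF hG] _ G0 -> ->]]]]].
  by exists d, F, G; split=> //; exact: on_variety_neq0 hG G0.
by exists d, F, G.
Qed.

(** The cross difference F G' - F' G is a form vanishing at the generic point, hence at [p]. *)
Lemma has_value_unique z c c' : has_value p z c -> has_value p z c' -> c = c'.
Proof.
move=> [d [F [G [hF hG G0 -> ->]]]] [e [F' [G' [hF' hG' G0' E ->]]]].
have G1 := on_variety_neq0 hG G0; have G1' := on_variety_neq0 hG' G0'.
apply/eqP; rewrite eqr_div // -subr_eq0; apply/eqP.
have [_ /(_ (d + e)%N (F * G' - F' * G))] := pointP p.
rewrite !rmorphB !rmorphM /=; apply.
  by apply: rpredB; [|rewrite addnC]; exact: dhomogM.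
by apply/eqP; rewrite subr_eq0 -eqr_div //; apply/eqP.
Qed.

Lemma has_valueD z c z' c' :
  has_value p z c -> has_value p z' c' -> has_value p (z + z') (c + c').
Proof. by move=> /has_valueE h /has_valueE h'; apply/has_valueE/ratioD. Qed.

Lemma has_valueM z c z' c' :
  has_value p z c -> has_value p z' c' -> has_value p (z * z') (c * c').
Proof. by move=> /has_valueE h /has_valueE h'; apply/has_valueE/ratioM. Qed.

Lemma has_value_cst a : has_value p (cst V a) a.
Proof. by apply/has_valueE; exact: ratio_cst. Qed.

Lemma has_value0 : has_value p 0 0.
Proof. by have := has_value_cst 0; rewrite rmorph0. Qed.

Lemma has_value1 : has_value p 1 1.
Proof. by have := has_value_cst 1; rewrite rmorph1. Qed.

Lemma has_value_neq0 z c : has_value p z c -> c != 0 -> z != 0.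
Proof.
by move=> h; apply: contraNneq => z0; apply/eqP/(has_value_unique h);
  rewrite z0; exact: has_value0.
Qed.

Lemma has_valueV z c : has_value p z c -> c != 0 -> has_value p z^-1 c^-1.
Proof.
move=> h c0; apply/has_valueE/ratioV => //; first exact/has_valueE.
exact: has_value_neq0 h c0.
Qed.

Lemma has_value_div z c z' c' : has_value p z c -> has_value p z' c' ->
  c' != 0 -> has_value p (z / z') (c / c').
Proof. by move=> h h' c0; apply: has_valueM => //; apply: has_valueV. Qed.

Lemma has_value_coord i j :
  p j != 0 -> has_value p (gpt (p := V) i / gpt (p := V) j) (p i / p j).
Proof.
move=> pj; apply/has_valueE/ratio_coord => //.
have := @on_variety_neq0 1 'X_j; rewrite mevalXU mmapX mmap1U; apply=> //.
by rewrite dhomogX; apply/eqP/mdeg1.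
Qed.

Lemma has_valueX z c e : has_value p z c -> has_value p (z ^+ e) (c ^+ e).
Proof.
move=> h; elim: e => [|e IH]; first by rewrite !expr0; exact: has_value1.
by rewrite !exprS; exact: has_valueM.
Qed.

Lemma has_value_mmap n (z : 'I_n -> K) (w : 'I_n -> k) (F : {mpoly k[n]}) :
  (forall i, has_value p (z i) (w i)) ->
  has_value p (mmap (cst V) z F) (F.@[w]).
Proof.
move=> h; apply: (@mmap_rel _ _ _ _ (cst V) idfun z w (has_value p)) => //.
- exact: has_value_cst.
- by move=> *; exact: has_valueD.
by move=> *; exact: has_valueM.
Qed.

Lemma has_value_horner (z : K) (w : k) (P : {poly k}) :
  has_value p z w -> has_value p (map_poly (cst V) P).[z] P.[w].
Proof.
move=> h; elim/poly_ind: P => [|P a IH].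
  by rewrite rmorph0 !horner0; exact: has_value0.
rewrite rmorphD rmorphM /= map_polyX map_polyC !hornerE.
apply: has_valueD; last exact: has_value_cst.
exact: has_valueM.
Qed.

Lemma regularD z z' : regular_at p z -> regular_at p z' -> regular_at p (z + z').
Proof. by move=> [c h] [c' h']; exists (c + c'); exact: has_valueD. Qed.

Lemma regularM z z' : regular_at p z -> regular_at p z' -> regular_at p (z * z').
Proof. by move=> [c h] [c' h']; exists (c * c'); exact: has_valueM. Qed.

Lemma regular_cst a : regular_at p (cst V a).
Proof. by exists a; exact: has_value_cst. Qed.

Lemma regularN z : regular_at p z -> regular_at p (- z).
Proof.
by move=> h; rewrite -mulN1r -(rmorphN1 (cst V)); apply: regularM => //;
  exact: regular_cst.
Qed.

Lemma regular_sum m (z : 'I_m -> K) :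
  (forall i, regular_at p (z i)) -> regular_at p (\sum_i z i).
Proof.
move=> h; elim/big_ind: _ => //; last exact: regularD.
by exists 0; exact: has_value0.
Qed.

End Values.

(* Clearing the denominators of the generic point by a power of a uniformizer  *)
(* gives the coordinates of the image of a nonsingular point.                  *)
Lemma nonsingular_image (k : closedFieldType) (C X : pvariety k)
    (psi : {rmorphism ffield X -> ffield C}) (p : point C) :
  (forall c, psi (cst X c) = cst C c) -> nonsingular_at p ->
  exists q : point X, forall z c, has_value q z c -> has_value p (psi z) c.
Proof.
move=> psic [t [t0 ht hz]].
pose g i := psi (gpt (p := X) i).
have [i0 gi0] := gpt_neq0 X.
have g0 i : (g i != 0) = (gpt (p := X) i != 0) by rewrite fmorph_eq0.
have hg i : exists mc : int * k, g i != 0 ->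
    mc.2 != 0 /\ has_value p (g i / t ^ mc.1) mc.2.
  (* A zero coordinate gets the default pair (0, 0), for which the claim is vacuous. *)
  have [->|/hz [m [c h]]] := eqVneq (g i) 0; first by exists (0, 0); rewrite eqxx.
  by exists (m, c).
have {hg}[mc hmc] := fin_all_exists hg.
rewrite -g0 in gi0; set m := fun i => (mc i).1.
(* The nonzero coordinate of least order at [p]: multiplying by [lam] makes every coordinate regular
   and this one a unit. *)
pose j := [arg min_(i < i0 | g i != 0) m i]%O.
have [gj hj] : g j != 0 /\ forall i, g i != 0 -> (m j <= m i)%R.
  by rewrite /j; case: arg_minP => // i gi h.
pose lam := t ^ (- m j); have lam0 : lam != 0 by rewrite expfz_neq0.
have hc i : exists c, has_value p (lam * g i) c /\ (i = j -> c != 0).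
  have [gi|gi] := eqVneq (g i) 0.
    exists 0; split; first by rewrite gi mulr0; exact: has_value0.
    by move=> ij; rewrite -ij gi eqxx in gj.
  have [ci hi] := hmc i gi.
  have [e e_def] : exists e : nat, m i - m j = e%:Z.
    by exists `|(m i - m j)%R|%N; rewrite gez0_abs // subr_ge0; exact: hj.
  (* The scaled coordinate is [t ^+ e] times a unit, so its value vanishes for positive [e]; for
     [i = j], [0 ^+ 0 = 1] keeps it nonzero. *)
  exists (0 ^+ e * (mc i).2); split; last first.
    by move=> ij; move: e_def; rewrite ij subrr => -[<-]; rewrite expr0 mul1r -ij.
  have -> : lam * g i = t ^+ e * (g i / t ^ m i).
    rewrite exprnP -e_def expfzDr // -/lam.
    have := expfz_neq0 (m i) t0; move: (t ^ m i) => a a0.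
    by rewrite [a * _]mulrC mulrACA mulfV ?mulr1.
  by apply: has_valueM => //; exact: has_valueX.
have {hc}[q hq] := fin_all_exists hc.
have hqF d (F : {mpoly k[(pdim X).+1]}) : F \is d.-homog ->
    has_value p (lam ^+ d * psi (mmap (cst X) (gpt (p := X)) F)) F.@[q].
  move=> hF; rewrite mmap_rmorph.
  have <- : mmap (cst C) g F = mmap (psi \o cst X) (psi \o gpt (p:=X)) F.
    apply: (@mmap_rel _ _ _ _ _ _ _ _ (fun u v => u = v)) => //.
    - by move=> a /=; rewrite psic.
    - by move=> ? ? ? ? -> ->.
    - by move=> ? ? ? ? -> ->.
  rewrite -mmap_scale //; apply: has_value_mmap => i; exact: (hq i).1.
have qP : on_variety (V := X) q.
  split; first by exists j; exact: (hq j).2.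
  move=> d F hF F0; have := hqF d F hF; rewrite F0 rmorph0 mulr0 => h.
  exact: has_value_unique h (has_value0 p).
exists (Point qP) => z c [d [F [G [hF hG G0 -> ->]]]].
have hFv := hqF d F hF; have hGv := hqF d G hG.
have := has_value_div hFv hGv G0.
by rewrite -mulf_div divff ?expf_neq0 // mul1r fmorph_div.
Qed.

(** Smoothness of C extends the rational map to every point; the image points are picked by
    choice. *)
Lemma morphism_of_embedding (k : closedFieldType) (C X : curve k)
    (psi : {rmorphism ffield X -> ffield C}) :
  (forall c, psi (cst X c) = cst C c) ->
  exists phi : morphism C X, pullback phi = psi.
Proof.
move=> psic.
have h p := constructive_indefinite_description _
  (nonsingular_image psic (curve_smooth p)).
pose f p := proj1_sig (h p).
by exists (@Morphism _ C X f psi psic (fun p => proj2_sig (h p))).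
Qed.

(** * The field k(x, sqrt Q) *)

Section Polynomials.
Variable k : closedFieldType.
Implicit Types (P Q S T : {poly k}) (a : k).

Definition simple_roots Q : Prop := forall a, root Q a -> ~~ root Q^`() a.

Lemma simple_roots_neq0 Q : simple_roots Q -> Q != 0.
Proof.
by move=> h; apply/eqP => Q0; have := h 0; rewrite Q0 deriv0 !root0 => /(_ isT).
Qed.

Lemma root_factor P a : root P a -> exists T, P = ('X - a%:P) * T.
Proof. by move=> /factor_theorem[T ->]; exists T; rewrite mulrC. Qed.

Lemma simple_root_factor Q a : simple_roots Q -> root Q a ->
  exists2 T, Q = ('X - a%:P) * T & T.[a] != 0.
Proof.
move=> h ra; have [T QE] := root_factor ra; exists T => //.
have := h _ ra; rewrite /root QE derivM derivXsubC mul1r !hornerE subrr mul0r addr0.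
by [].
Qed.

Lemma double_root_factor P a : root P a -> root P^`() a ->
  exists U, P = ('X - a%:P) ^+ 2 * U.
Proof.
move=> /root_factor[T PE]; rewrite /root PE derivM derivXsubC mul1r !hornerE.
by rewrite subrr mul0r addr0 => /root_factor[U ->]; exists U; rewrite expr2 mulrA.
Qed.

Lemma simple_roots_sqr Q a U : simple_roots Q -> Q = ('X - a%:P) ^+ 2 * U -> False.
Proof.
move=> h QE; have ra : root Q a.
  by rewrite QE /root expr2 -mulrA hornerM hornerXsubC subrr mul0r.
case/negP: (h _ ra); apply/eqP; rewrite QE expr2 !derivM derivXsubC !hornerE.
by rewrite subrr !(mul0r, mulr0, addr0) /= add0r subrr mul0r.
Qed.

(** Squares of linear factors at double roots are split off until none is left. *)
Lemma squarefree_part P :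
  P != 0 -> exists S Q, P = S ^+ 2 * Q /\ simple_roots Q.
Proof.
have [n] := ubnP (size P); elim: n P => // n IH P le P0.
case: (classic (simple_roots P)) => [h|h].
  by exists 1, P; rewrite expr1n mul1r.
have [a ra ra'] : exists2 a, root P a & root P^`() a.
  apply: NNPP => h'; apply: h => a ra; apply/negP => ra'; apply: h'.
  by exists a.
have [U PE] := double_root_factor ra ra'; rewrite PE in P0 le *.
have U0 : U != 0 by move: P0; rewrite mulf_eq0 negb_or => /andP[].
have [|S [Q [-> hQ]]] := IH U _ U0.
  move: le; rewrite expr2 -mulrA !size_monicM ?monicXsubC ?mulf_neq0 ?polyXsubC_eq0 //.
  by rewrite !size_XsubC; exact: ltnW.
by exists (('X - a%:P) * S), Q; split=> //; rewrite exprMn mulrA.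
Qed.

(** At a root of Q the multiplicity of A^2 is even and that of B^2 Q is odd. Thus Q is not a square
    in k(x). *)
Lemma square_ratio_simple_roots A B Q : simple_roots Q -> (1 < size Q)%N ->
  A ^+ 2 = B ^+ 2 * Q -> B = 0.
Proof.
move=> hQ sQ; apply: contra_eq => B0.
have /closed_rootP[a ra] : size Q != 1%N by rewrite neq_ltn sQ orbT.
have [T QE Ta] := simple_root_factor hQ ra.
have Q0 := simple_roots_neq0 hQ; apply/eqP => E.
have A0 : A != 0.
  by apply/eqP => A0; move/eqP: E; rewrite A0 expr0n eq_sym mulf_eq0 expf_eq0
    (negPf B0) (negPf Q0).
move/(congr1 (mup a)): E.
rewrite !expr2 (mupM _ A0 A0) (mupM _ (mulf_neq0 B0 B0) Q0) (mupM _ B0 B0) QE.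
rewrite mupMl; last by rewrite /root.
rewrite -['X - _]expr1 mup_XsubCX eqxx !addnn => /(congr1 odd).
by rewrite oddD !odd_double.
Qed.

Lemma comp_polyNX P :
  P \Po (- 'X) = even_poly P \Po 'X^2 - (odd_poly P \Po 'X^2) * 'X.
Proof.
rewrite -{1}[P]poly_even_odd rmorphD rmorphM /= -!comp_polyA comp_polyX.
by rewrite rmorphXn /= comp_polyX sqrrN mulrN.
Qed.

Lemma even_poly_comp P : 2%:R != 0 :> k -> P \Po (- 'X) = P ->
  P = even_poly P \Po 'X^2.
Proof.
move=> two; rewrite comp_polyNX -{3 4}[P]poly_even_odd => /addrI/eqP.
rewrite eq_sym -addr_eq0 -mulr2n -scaler_nat scaler_eq0 (negPf two) /= => /eqP->.
by rewrite addr0.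
Qed.

End Polynomials.

Section EvPoly.
Variables (k : closedFieldType) (K : fieldType) (c : {rmorphism k -> K}) (x : K).

Definition ev : {poly k} -> K := horner_eval x \o map_poly c.

HB.instance Definition _ := GRing.RMorphism.on ev.

Lemma evE P : ev P = (map_poly c P).[x]. Proof. by []. Qed.

Lemma evC a : ev a%:P = c a.
Proof. by rewrite evE map_polyC hornerC. Qed.

Lemma evX : ev 'X = x.
Proof. by rewrite evE map_polyX hornerX. Qed.

Lemma evZ a P : ev (a *: P) = c a * ev P.
Proof. by rewrite -mul_polyC rmorphM /= evC. Qed.

Lemma ev_ind (P : {poly k} -> K -> Prop) :
  (forall a, P a%:P (c a)) -> P 'X x ->
  (forall A B u v, P A u -> P B v -> P (A + B) (u + v)) ->
  (forall A B u v, P A u -> P B v -> P (A * B) (u * v)) ->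
  forall A, P A (ev A).
Proof.
move=> PC PX PD PM; elim/poly_ind => [|A a IH].
  by have := PC 0; rewrite !rmorph0.
rewrite rmorphD rmorphM /= evX evC; apply: PD; last exact: PC.
exact: PM.
Qed.

End EvPoly.

Lemma ev_rmorph (k : closedFieldType) (K L : fieldType)
    (c : {rmorphism k -> K}) (c' : {rmorphism k -> L}) (s : {rmorphism K -> L}) :
  (forall a, s (c a) = c' a) ->
  forall x A, s (ev c x A) = ev c' (s x) A.
Proof.
move=> sc x A; rewrite !evE -horner_map /= -map_poly_comp; congr horner.
by apply: eq_map_poly => a /=.
Qed.

Lemma ev_comp (k : closedFieldType) (K : fieldType) (c : {rmorphism k -> K}) x A B :
  ev c x (A \Po B) = ev c (ev c x B) A.
Proof. by rewrite !evE map_comp_poly horner_comp. Qed.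

(** K = k(x, y), x transcendental over k, y^2 = Q(x) with Q squarefree and not constant. Generation
    is stated with cleared denominators, so that only polynomials in x are ever handled, not the
    field k(x). *)
Record quadratic_field (k : closedFieldType) (K : fieldType)
    (c : {rmorphism k -> K}) (x y : K) (Q : {poly k}) : Prop := QuadraticField {
  quad_inj : forall P, ev c x P = 0 -> P = 0;
  quad_sqr : y ^+ 2 = ev c x Q;
  quad_simple : simple_roots Q;
  quad_size : (1 < size Q)%N;
  quad_gen : forall z, exists A B E,
    E != 0 /\ z * ev c x E = ev c x A + ev c x B * y
}.

Section Quadratic.
Variables (k : closedFieldType) (K : fieldType) (c : {rmorphism k -> K}).
Variables (x y : K) (Q : {poly k}).
Hypothesis q : quadratic_field c x y Q.
Hypothesis two : 2%:R != 0 :> k.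
Local Notation ev := (ev c x).

Lemma quad_two : 2%:R != 0 :> K.
Proof. by rewrite -(rmorph_nat c) fmorph_eq0. Qed.

Lemma quad_ev_eq0 P : (ev P == 0) = (P == 0).
Proof.
by apply/eqP/eqP => [|->]; [exact: quad_inj q _ | rewrite rmorph0].
Qed.

Lemma quad_ev_inj : injective ev.
Proof.
move=> A B /eqP; rewrite -subr_eq0 -rmorphB quad_ev_eq0 subr_eq0; exact/eqP.
Qed.

(** Squaring A = - B y gives A^2 = B^2 Q, which forces B = 0. *)
Lemma quad_indep A B : ev A + ev B * y = 0 -> A = 0 /\ B = 0.
Proof.
move=> /eqP; rewrite addr_eq0 => /eqP E.
have B0 : B = 0.
  apply: (square_ratio_simple_roots (A := A) (quad_simple q) (quad_size q)).
  apply: quad_ev_inj; rewrite [RHS]rmorphM !rmorphXn /= E sqrrN exprMn.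
  by rewrite (quad_sqr q).
by split=> //; apply/eqP; rewrite -quad_ev_eq0 E B0 rmorph0 mul0r oppr0.
Qed.

Lemma quad_uniq A B A' B' :
  ev A + ev B * y = ev A' + ev B' * y -> A = A' /\ B = B'.
Proof.
move=> E; have [|] := @quad_indep (A - A') (B - B').
  rewrite !rmorphB /= mulrBl addrACA -opprD E addrN //.
by move=> /subr0_eq-> /subr0_eq->.
Qed.

Lemma quad_y_neq0 : y != 0.
Proof.
have := quad_ev_eq0 Q; rewrite -(quad_sqr q) sqrf_eq0 => ->.
exact: simple_roots_neq0 (quad_simple q).
Qed.

Let y1 := ev Q^`() / (2%:R * y).

(* z E(x) = A(x) + B(x) y is differentiated by Leibniz' rule, with y' = y1. *)
Let deriv_rel (z w : K) := exists A B E,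
  [/\ E != 0, z * ev E = ev A + ev B * y
    & w * ev E + z * ev E^`() = ev A^`() + ev B^`() * y + ev B * y1].

(** Two presentations of z satisfy A E' = A' E and B E' = B' E; differentiating these identities
    shows that they prescribe the same derivative. *)
Let deriv_rel_uniq z w w' : deriv_rel z w -> deriv_rel z w' -> w = w'.
Proof.
move=> [A [B [E [E0 zE wE]]]] [A' [B' [E' [E0' zE' wE']]]].
have [EA EB] : A * E' = A' * E /\ B * E' = B' * E.
  apply: quad_uniq; rewrite !rmorphM /= !(mulrAC _ (ev E')) -mulrDl -zE.
  by rewrite !(mulrAC _ (ev E)) -mulrDl -zE' mulrAC.
move/(congr1 (fun R : {poly k} => ev R^`())): EA.
move/(congr1 (fun R : {poly k} => ev R^`())): (EB).
move/(congr1 ev): EB.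
rewrite !derivM !rmorphD !rmorphM /= => EB EB' EA'.
have e0 : ev E != 0 by rewrite quad_ev_eq0.
have e0' : ev E' != 0 by rewrite quad_ev_eq0.
apply: (mulIf (mulf_neq0 e0 e0')).
move: (ev E) (ev E') (ev A) (ev A') (ev B) (ev B') (ev E^`()) (ev E'^`())
  (ev A^`()) (ev A'^`()) (ev B^`()) (ev B'^`()) zE zE' wE wE' EA' EB EB'.
clear=> e e' a a' b b' de de' da da' db db' zE zE' wE wE' EA EB EB'.
have -> : w * (e * e') = (da + db * y + b * y1 - z * de) * e'.
  by rewrite -wE; ring.
have -> : w' * (e * e') = (da' + db' * y + b' * y1 - z * de') * e.
  by rewrite -wE'; ring.
have h1 : da * e' = da' * e + a' * de - a * de'.
  by rewrite -EA; ring.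
have h2 : db * e' = db' * e + b' * de - b * de'.
  by rewrite -EB'; ring.
have h3 : z * de * e' = (a' + b' * y) * de by rewrite -zE'; ring.
have h4 : z * de' * e = (a + b * y) * de' by rewrite -zE; ring.
transitivity (da * e' + db * e' * y + b * e' * y1 - z * de * e'); first by ring.
rewrite h1 h2 h3 EB; apply/eqP; rewrite -subr_eq0; apply/eqP.
transitivity (z * de' * e - (a + b * y) * de'); first by ring.
by rewrite h4 subrr.
Qed.

Let deriv_rel_ex z : exists w, deriv_rel z w.
Proof.
have [A [B [E [E0 zE]]]] := quad_gen q z.
exists ((ev A^`() + ev B^`() * y + ev B * y1 - z * ev E^`()) / ev E), A, B, E.
by split=> //; rewrite divfK ?quad_ev_eq0 // subrK.
Qed.

(** The derivation d/dx of K. It is chosen by [epsilon]; since [deriv_rel] determines its second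
    argument, each rule below is proved by exhibiting a presentation of the result. *)
Definition quad_der (z : K) : K := epsilon (inhabits 0) (deriv_rel z).

Let quad_derP z : deriv_rel z (quad_der z).
Proof. exact: epsilon_spec (deriv_rel_ex z). Qed.

Let quad_derE z w : deriv_rel z w -> quad_der z = w.
Proof. exact: deriv_rel_uniq. Qed.

Lemma quad_der_ev A : quad_der (ev A) = ev A^`().
Proof.
apply: quad_derE; exists A, 0, 1; rewrite oner_neq0 linear0 !derivC.
by split; rewrite // !(rmorph0, rmorph1) ?mul0r ?addr0 ?mulr0 ?mulr1 ?addr0.
Qed.

Lemma quad_der_y : 2%:R * y * quad_der y = ev Q^`().
Proof.
rewrite (@quad_derE _ y1); first by rewrite mulrC divfK // mulf_neq0 ?quad_two ?quad_y_neq0.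
exists 0, 1, 1; rewrite oner_neq0 linear0 !derivC.
by split; rewrite // !(rmorph0, rmorph1) ?mul0r ?addr0 ?mulr0 ?mulr1 ?addr0 ?add0r ?mul1r.
Qed.

Lemma quad_derD u v : quad_der (u + v) = quad_der u + quad_der v.
Proof.
have [A [B [E [E0 zE wE]]]] := quad_derP u.
have [A' [B' [E' [E0' zE' wE']]]] := quad_derP v.
apply: quad_derE; exists (A * E' + A' * E), (B * E' + B' * E), (E * E').
rewrite mulf_neq0 // !(derivM, derivD) !(rmorphD, rmorphM) /=.
split=> //.
  transitivity (u * ev E * ev E' + v * ev E' * ev E); first by ring.
  by rewrite zE zE'; ring.
transitivity ((quad_der u * ev E + u * ev E^`()) * ev E'
  + (quad_der v * ev E' + v * ev E'^`()) * ev E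
  + u * ev E * ev E'^`() + v * ev E' * ev E^`()); first by ring.
by rewrite wE wE' zE zE'; ring.
Qed.

Lemma quad_derM u v : quad_der (u * v) = u * quad_der v + v * quad_der u.
Proof.
have [A [B [E [E0 zE wE]]]] := quad_derP u.
have [A' [B' [E' [E0' zE' wE']]]] := quad_derP v.
apply: quad_derE; exists (A * A' + B * B' * Q), (A * B' + A' * B), (E * E').
have yQ := quad_sqr q.
have yQ' : 2%:R * y * y1 = ev Q^`().
  by rewrite mulrC divfK // mulf_neq0 ?quad_two ?quad_y_neq0.
rewrite mulf_neq0 // !(derivM, derivD) !(rmorphD, rmorphM) /= -yQ -yQ'.
split=> //.
  by rewrite mulrACA zE zE'; ring.
transitivity ((quad_der u * ev E + u * ev E^`()) * (v * ev E')
  + (quad_der v * ev E' + v * ev E'^`()) * (u * ev E)); first by ring.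
by rewrite wE wE' zE zE'; ring.
Qed.

Lemma quad_der_cst a : quad_der (c a) = 0.
Proof. by rewrite -(evC c x) quad_der_ev derivC rmorph0. Qed.

Lemma quad_der_x : quad_der x = 1.
Proof. by rewrite -{1}(evX c x) quad_der_ev derivX rmorph1. Qed.

Section Derivation.
Variable D : K -> K.
Hypotheses (D_add : forall a b, D (a + b) = D a + D b)
  (D_mul : forall a b, D (a * b) = a * D b + b * D a)
  (D_cst : forall a, D (c a) = 0).

(** A derivation over k is determined by its value at x: on k[x] by the Leibniz rule, at y by
    differentiating y^2 = Q(x), elsewhere by z E = A + B y. So the derivations form a line over K,
    and a form is known from its value at d/dx. *)
Lemma quad_der_unique z : D z = D x * quad_der z.
Proof.
have D_ev A : D (ev A) = ev A^`() * D x.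
  elim/poly_ind: A => [|A a IH].
    by rewrite deriv0 !rmorph0 mul0r -(rmorph0 c) D_cst rmorph0.
  rewrite derivD derivM derivX derivC addr0 mulr1 !(rmorphD, rmorphM) /= evX evC.
  by rewrite D_add D_mul D_cst IH; ring.
have Dy : D y = D x * y1.
  have y0 := mulf_neq0 quad_two quad_y_neq0; apply: (mulfI y0).
  rewrite mulrCA [X in _ = D x * X]mulrC divfK // mulrC [RHS]mulrC -D_ev.
  rewrite -(quad_sqr q).
  by rewrite expr2 D_mul; ring.
have [A [B [E [E0 zE wE]]]] := quad_derP z.
have e0 : ev E != 0 by rewrite quad_ev_eq0.
apply: (mulIf e0); have := congr1 D zE; rewrite D_add !D_mul !D_ev Dy => h.
have -> : D z * ev E = ev E * D z by ring.
apply: (addrI (z * (ev E^`() * D x))); rewrite h.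
transitivity (D x * (quad_der z * ev E + z * ev E^`())); last by ring.
by rewrite wE; ring.
Qed.

End Derivation.

End Quadratic.

(** * The change of coordinates at infinity *)

Section Reversal.
Variables (k : closedFieldType).

(* X^d P(1/X); meaningful when size P <= d.+1. *)
Definition revp d (P : {poly k}) : {poly k} :=
  \poly_(i < d.+1) P`_(d - i)%N.

Lemma size_revp d (P : {poly k}) : (size (revp d P) <= d.+1)%N.
Proof. exact: size_poly. Qed.

Variables (K : fieldType) (c : {rmorphism k -> K}) (x : K).
Hypothesis x0 : x != 0.

Lemma ev_revp d (P : {poly k}) : (size P <= d.+1)%N ->
  ev c x (revp d P) = x ^+ d * ev c x^-1 P.
Proof.
move=> sP; rewrite !evE (horner_coef_wide _ (n := d.+1)); last first.
  by rewrite size_map_poly size_revp.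
rewrite (horner_coef_wide _ (n := d.+1)) ?size_map_poly // mulr_sumr.
rewrite (reindex_inj rev_ord_inj) /=; apply: eq_bigr => i _.
rewrite !coef_map coef_poly /= subSS ltnS leq_subr subKn -1?ltnS //.
rewrite mulrCA; congr (_ * _); rewrite exprVn.
have -> : x ^+ d = x ^+ (d - i) * x ^+ i by rewrite -exprD subnK // -ltnS.
by rewrite mulfK // expf_neq0.
Qed.

End Reversal.

Section Inverse.
Variables (k : closedFieldType) (K : fieldType) (c : {rmorphism k -> K}).
Variables (x y : K) (Q : {poly k}).
Hypothesis q : quadratic_field c x y Q.
Local Notation m := (size Q)./2.

Lemma quad_x_neq0 : x != 0.
Proof. by rewrite -(evX c x) (quad_ev_eq0 q) polyX_eq0. Qed.
Let x0 := quad_x_neq0.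

Lemma quad_m_gt0 : (0 < m)%N.
Proof. by rewrite half_gt0 (quad_size q). Qed.

Lemma quad_size_le : (size Q <= m.*2.+1)%N.
Proof. by rewrite -{1}(odd_double_half (size Q)); case: odd. Qed.

Lemma revp_inj d (P : {poly k}) : (size P <= d.+1)%N -> revp d P = 0 -> P = 0.
Proof.
move=> sP P0; have E : ev c x^-1 P = 0.
  have := ev_revp c x0 sP; rewrite P0 rmorph0 => /esym/eqP.
  by rewrite mulf_eq0 expf_eq0 (negPf x0) andbF => /eqP.
have R : ev c x^-1 (revp d (revp d P)) = 0.
  have := @ev_revp k K c _ (invr_neq0 x0) d _ (size_revp d P).
  by rewrite P0 !rmorph0 mulr0.
apply/polyP => i; rewrite coef0; case: (ltnP i d.+1) => [lt|le].
  have := congr1 (fun R : {poly k} => R`_(d - i)) P0.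
  by rewrite coef_poly coef0 subKn // ltnS leq_subr.
by rewrite nth_default // (leq_trans sP).
Qed.

Lemma ev_revpV d (P : {poly k}) : (size P <= d.+1)%N ->
  ev c x^-1 (revp d P) = x ^- d * ev c x P.
Proof. by move=> /(ev_revp c (invr_neq0 x0)) ->; rewrite invrK exprVn. Qed.

(** Dividing y^2 = Q(x) by x^(2m) gives the equation at infinity, where 2m is the least even bound
    for deg Q. A square factor of the reversed polynomial would reverse back to a square factor of
    Q, or to a drop of its degree. *)
Lemma quadratic_inverse : quadratic_field c x^-1 (y / x ^+ m) (revp m.*2 Q).
Proof.
have sQ := quad_size_le; have m0 := quad_m_gt0.
have m2 : (2 <= m.*2)%N by lia.
have QE : ev c x Q = x ^+ m.*2 * ev c x^-1 (revp m.*2 Q).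
  by rewrite ev_revpV // mulVKf // expf_neq0.
have dbl a U : revp m.*2 Q = ('X - a%:P) ^+ 2 * U -> False.
  move=> E; have sU : (size U <= (m.*2 - 2).+1)%N.
    have [->|U0] := eqVneq U 0; first by rewrite size_poly0.
    have := size_revp m.*2 Q; rewrite E expr2 -mulrA.
    rewrite !size_monicM ?monicXsubC ?mulf_neq0 ?polyXsubC_eq0 // !size_XsubC.
    move: (size U) ((size Q)./2) m2 => s M.
    lia.
  have {}E : Q = ('X * a%:P - 1) ^+ 2 * revp (m.*2 - 2) U.
    apply: (quad_ev_inj q); rewrite QE E !(rmorphXn, rmorphM) !rmorphB !rmorphM /=.
    rewrite !evX !evC rmorph1 ev_revp // -(subnKC m2) exprD.
    by rewrite mulrACA -exprMn mulrBr mulfV // -[in RHS]sqrrN opprB subnKC.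
  (* A double root at 0 of the reversed polynomial would mean deg Q <= 2m - 2, whereas deg Q is 2m -
     1 or 2m. *)
  have [a0|a0] := eqVneq a 0.
    move: E; rewrite a0 mulr0 sub0r sqrrN expr1n mul1r => E.
    by have := size_revp (m.*2 - 2) U; rewrite -E; lia.
  apply: (@simple_roots_sqr _ Q a^-1 (a ^+ 2 *: revp (m.*2 - 2) U)).
    exact: quad_simple q.
  rewrite {1}E -scalerAr scalerAl -mul_polyC rmorphXn /= -exprMn mulrBr.
  by rewrite -polyCM mulfV // ['X * _]mulrC.
split.
- move=> P P0; apply: (@revp_inj (size P)) => //.
  by apply: (quad_inj q); rewrite ev_revp // P0 mulr0.
- by rewrite exprMn (quad_sqr q) ev_revpV // -exprVn -exprM muln2 mulrC exprVn.
- move=> a ra; apply/negP => ra'.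
  by have [U /dbl] := double_root_factor ra ra'.
(* A constant reversal would make Q a multiple of x^(2m), which x^2 divides. *)
- rewrite ltnNge; apply/negP => /size1_polyC E.
  have : Q = ('X - 0%:P) ^+ 2 * ((revp m.*2 Q)`_0 *: 'X^(m.*2 - 2)).
    apply: (quad_ev_inj q); rewrite QE {1}E evC subr0 -scalerAr -exprD subnKC //.
    by rewrite evZ rmorphXn /= evX mulrC.
  exact: simple_roots_sqr (quad_simple q).
move=> z; have [A [B [E [E0 zE]]]] := quad_gen q z.
pose d := (size A + size B + size E)%N.
have sA : (size A <= d.+1)%N by rewrite leqW // /d -addnA leq_addr.
have sB : (size B <= d.+1)%N by rewrite leqW // /d addnAC leq_addl.
have sE : (size E <= d.+1)%N by rewrite leqW // leq_addl.
exists (revp d A * 'X^m), (revp d B), (revp d E * 'X^m); split.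
  rewrite mulf_neq0 ?expf_neq0 ?polyX_eq0 //; apply/eqP => /(revp_inj sE)/eqP.
  by rewrite (negPf E0).
rewrite !rmorphM !rmorphXn /= evX !ev_revpV //.
transitivity (x ^- d / x ^+ m * (z * ev c x E)); first by rewrite exprVn; ring.
by rewrite zE exprVn; ring.
Qed.

End Inverse.

(** * Hyperelliptic models *)

Section LocalUniformizer.
Variables (k : closedFieldType) (V : pvariety k) (p : point V).
Local Notation K := (ffield V).

Section Order.
Variables (t : K) (t0 : t != 0).

Definition has_order (z : K) : Prop :=
  exists (m : int) (c : k), c != 0 /\ has_value p (z / t ^ m) c.

Lemma has_order_unit z c : has_value p z c -> c != 0 -> has_order z.
Proof. by move=> h c0; exists 0, c; rewrite expr0z divr1. Qed.

Lemma has_orderM z z' : has_order z -> has_order z' -> has_order (z * z').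
Proof.
move=> [m [c [c0 h]]] [m' [c' [c0' h']]]; exists (m + m'), (c * c').
rewrite mulf_neq0 //; split=> //.
by rewrite expfzDr // invfM mulrACA; exact: has_valueM.
Qed.

Lemma has_orderV z : has_order z -> has_order z^-1.
Proof.
move=> [m [c [c0 h]]]; exists (- m), c^-1; rewrite invr_eq0; split=> //.
by rewrite -invr_expz -invfM; exact: has_valueV.
Qed.

Lemma has_order_uniformizer : has_order t.
Proof.
by exists 1, 1; rewrite oner_neq0 expr1z mulfV //; split=> //; exact: has_value1.
Qed.

Lemma has_orderX z n : has_order z -> has_order (z ^+ n).
Proof.
move=> h; elim: n => [|n IH]; last by rewrite exprS; exact: has_orderM.
by rewrite expr0; apply: has_order_unit (has_value1 p) (oner_neq0 _).
Qed.

End Order.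

Variables (x y : K) (Q : {poly k}) (a b : k).
Hypothesis q : quadratic_field (cst V) x y Q.
Hypothesis two : 2%:R != 0 :> k.
Hypotheses (xa : has_value p x a) (yb : has_value p y b).
Local Notation ev := (ev (cst V) x).

Lemma has_value_ev P : has_value p (ev P) P.[a].
Proof. exact: has_value_horner. Qed.

Lemma has_value_lin A B : has_value p (ev A + ev B * y) (A.[a] + B.[a] * b).
Proof.
by apply: has_valueD; [|apply: has_valueM]=> //; exact: has_value_ev.
Qed.

Lemma chart_point_eq : b ^+ 2 = Q.[a].
Proof.
apply: (has_value_unique (has_valueX 2 yb)).
by rewrite (quad_sqr q); exact: has_value_ev.
Qed.

Lemma ev_XsubC : ev ('X - a%:P) = x - cst V a.
Proof. by rewrite rmorphB /= evX evC. Qed.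

Lemma ev_XsubC_neq0 : x - cst V a != 0.
Proof. by rewrite -ev_XsubC (quad_ev_eq0 q) polyXsubC_eq0. Qed.

Lemma has_order_ev t P : t != 0 -> has_order t (x - cst V a) -> P != 0 ->
  has_order t (ev P).
Proof.
move=> t0 hx P0; have [n [P1 /implyP/(_ P0) ra ->]] := multiplicity_XsubC P a.
rewrite rmorphM rmorphXn /= ev_XsubC; apply: has_orderM => //.
  exact: has_order_unit (has_value_ev P1) ra.
exact: has_orderX.
Qed.

(* A common factor x - a of A and B is removed first. *)
Lemma has_order_all t : t != 0 -> has_order t (x - cst V a) ->
  (forall A B, ~~ root A a || ~~ root B a -> has_order t (ev A + ev B * y)) ->
  forall z, z != 0 -> has_order t z.
Proof.
move=> t0 hx h.
have lin A B : ev A + ev B * y != 0 -> has_order t (ev A + ev B * y).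
  have [n] := ubnP (size A + size B)%N; elim: n A B => // n IH A B le z0.
  have [rA|rA] := boolP (root A a); last by apply: h; rewrite rA.
  have [rB|rB] := boolP (root B a); last by apply: h; rewrite rB orbT.
  have [A1 AE] := root_factor rA; have [B1 BE] := root_factor rB.
  have E : ev A + ev B * y = (x - cst V a) * (ev A1 + ev B1 * y).
    by rewrite AE BE !rmorphM /= ev_XsubC -mulrA mulrDr.
  rewrite E; apply: has_orderM => //; apply: IH; last first.
    by move: z0; rewrite E mulf_eq0 negb_or => /andP[].
  have sz (R R1 : {poly k}) : R = ('X - a%:P) * R1 ->
      R = 0 /\ R1 = 0 \/ size R = (size R1).+1.
    move=> ->; have [->|R0] := eqVneq R1 0; first by left; rewrite mulr0.
    by right; rewrite size_monicM ?monicXsubC // size_XsubC.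
  move: le; case: (sz _ _ AE) => [[A0 ->]|->]; case: (sz _ _ BE) => [[B0 ->]|->].
  - by move: z0; rewrite A0 B0 !rmorph0 mul0r addr0 eqxx.
  - by rewrite A0 size_poly0 !add0n.
  - by rewrite B0 size_poly0 !addn0.
  by rewrite addSn addnS ltnS => /ltnW.
move=> z z0; have [A [B [E [E0 zE]]]] := quad_gen q z.
have e0 : ev E != 0 by rewrite (quad_ev_eq0 q).
have -> : z = (ev A + ev B * y) / ev E by rewrite -zE mulfK.
apply: has_orderM => //; first by apply: lin; rewrite -zE mulf_neq0.
by apply: has_orderV => //; exact: has_order_ev.
Qed.

(** If b is nonzero, x - a is a uniformizer: when A and B do not both vanish at a, one of A + B y
    and A - B y is a unit at [p], and their product A^2 - B^2 Q is a polynomial in x. If b = 0, then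
    a is a simple root of Q, x - a is y^2 times a unit, and y is a uniformizer. *)
Lemma chart_nonsingular : nonsingular_at p.
Proof.
have [b0|b0] := eqVneq b 0; last first.
  have x0 := ev_XsubC_neq0; exists (x - cst V a); split=> //.
    have := has_value_ev ('X - a%:P).
    by rewrite ev_XsubC hornerXsubC subrr.
  apply: has_order_all => // [|A B AB]; first exact: has_order_uniformizer.
  have [s0|s0] := eqVneq (A.[a] + B.[a] * b) 0; last first.
    exact: has_order_unit (has_value_lin A B) s0.
  have s0' : A.[a] + (- B).[a] * b != 0.
    apply/eqP => s0'; move: AB; rewrite /root hornerN in s0' *.
    have A0 : A.[a] = 0.
      apply: (mulfI two); rewrite mulr0.
      transitivity ((A.[a] + B.[a] * b) + (A.[a] + - B.[a] * b)); first by ring.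
      by rewrite s0 s0' addr0.
    move: s0; rewrite A0 add0r => /eqP; rewrite mulf_eq0 (negPf b0) orbF => /eqP->.
    by rewrite eqxx.
  have vB := has_value_lin A (- B); have nB := has_value_neq0 vB s0'.
  have N : (ev A + ev B * y) * (ev A + ev (- B) * y) = ev (A ^+ 2 - B ^+ 2 * Q).
    rewrite rmorphB rmorphXn rmorphM rmorphXn rmorphN /= -(quad_sqr q).
    by rewrite mulNr mulrC -subr_sqr exprMn.
  have [z0|z0] := eqVneq (ev A + ev B * y) 0.
    have [A0 B0] := quad_indep q z0; move: AB; rewrite A0 B0 !root0 //.
  have -> : ev A + ev B * y = ev (A ^+ 2 - B ^+ 2 * Q) / (ev A + ev (- B) * y).
    by rewrite -N mulfK.
  apply: has_orderM => //; last first.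
    by apply: has_orderV => //; exact: has_order_unit vB s0'.
  apply: has_order_ev => //; first exact: has_order_uniformizer.
  by rewrite -(quad_ev_eq0 q) -N mulf_neq0.
have y0 := quad_y_neq0 q.
have [|T QE Ta] := @simple_root_factor _ Q a (quad_simple q).
  by rewrite /root -chart_point_eq b0 expr0n.
have xT : x - cst V a = y ^+ 2 * (ev T)^-1.
  rewrite (quad_sqr q) QE rmorphM /= ev_XsubC mulfK //.
  exact: has_value_neq0 (has_value_ev T) Ta.
have yb0 : has_value p y 0 by rewrite -b0.
exists y; split=> //.
apply: has_order_all => // [|A B AB].
  rewrite xT; apply: has_orderM => //.
    by apply: has_orderX => //; exact: has_order_uniformizer.
  by apply: has_orderV => //; exact: has_order_unit (has_value_ev T) Ta.
have [ra|ra] := boolP (root A a); last first.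
  by apply: has_order_unit (has_value_lin A B) _; rewrite b0 mulr0 addr0.
rewrite ra /= in AB; have [A1 AE] := root_factor ra.
have -> : ev A + ev B * y = y * (ev B + ev A1 * (y * (ev T)^-1)).
  by rewrite AE rmorphM /= ev_XsubC xT expr2; ring.
apply: has_orderM => //; first exact: has_order_uniformizer.
apply: (@has_order_unit _ _ (B.[a] + A1.[a] * (0 * T.[a]^-1))).
  apply: has_valueD; first exact: has_value_ev.
  apply: has_valueM; first exact: has_value_ev.
  by apply: has_valueM => //; apply: has_valueV => //; exact: has_value_ev.
by rewrite mul0r mulr0 addr0.
Qed.

End LocalUniformizer.

(* Regularity at p of a form sum_i g_i dh_i, seen through one derivation D.    *)
Definition der_regular_at (k : closedFieldType) (V : pvariety k) (p : point V)
    (D : ffield V -> ffield V) (f : ffield V) : Prop :=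
  exists m (g h : 'I_m -> ffield V),
    [/\ forall i, regular_at p (g i), forall i, regular_at p (h i)
      & f = \sum_i g i * D (h i)].

Lemma der_regular_at1 (k : closedFieldType) (V : pvariety k) (p : point V)
    D g h : regular_at p g -> regular_at p h -> der_regular_at p D (g * D h).
Proof.
by move=> hg hh; exists 1%N, (fun=> g), (fun=> h); split=> //; rewrite big_ord1.
Qed.

(** The part of V where coordinate [i0] is nonzero has coordinate ring k[x, y]; it is the plane
    affine curve y^2 = Q(x). *)
Record affine_chart (k : closedFieldType) (V : pvariety k) (x y : ffield V)
    (i0 : 'I_(pdim V).+1) : Prop := AffineChart {
  chart_neq0 : gpt i0 != 0;
  chart_lin : forall i, exists A B,
    gpt i / gpt i0 = ev (cst V) x A + ev (cst V) x B * y;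
  chart_x : exists j, gpt j / gpt i0 = x;
  chart_y : exists j, gpt j / gpt i0 = y
}.

Section Chart.
Variables (k : closedFieldType) (V : pvariety k) (x y : ffield V) (Q : {poly k}).
Variable i0 : 'I_(pdim V).+1.
Hypothesis q : quadratic_field (cst V) x y Q.
Hypothesis two : 2%:R != 0 :> k.
Hypothesis hV : affine_chart x y i0.
Local Notation ev := (ev (cst V) x).
Local Notation D := (quad_der (cst V) x y Q).

Lemma chart_values (p : point V) : p i0 != 0 ->
  exists a b, has_value p x a /\ has_value p y b.
Proof.
move=> p0; have [j xE] := chart_x hV; have [l yE] := chart_y hV.
exists (p j / p i0), (p l / p i0); rewrite -xE -yE.
by split; exact: has_value_coord.
Qed.

Lemma chart_nonsingular_at (p : point V) : p i0 != 0 -> nonsingular_at p.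
Proof.
by move=> /chart_values[a [b [xa yb]]]; exact: chart_nonsingular q two xa yb.
Qed.

(** The specialization x -> a, y -> b is well defined on k[x, y] because A + B y determines A and B;
    the point consists of the images of the affine coordinates. *)
Lemma chart_point a b : b ^+ 2 = Q.[a] ->
  exists p : point V, [/\ p i0 != 0, has_value p x a & has_value p y b].
Proof.
move=> ab; have [A hA] := fin_all_exists (chart_lin hV).
have {hA}[B hAB] := fin_all_exists hA.
pose w i := (A i).[a] + (B i).[a] * b.
have lin_uniq A1 B1 A2 B2 : ev A1 + ev B1 * y = ev A2 + ev B2 * y ->
    A1.[a] + B1.[a] * b = A2.[a] + B2.[a] * b.
  by move=> /(quad_uniq q)[-> ->].
have w0 : w i0 = 1.
  have := lin_uniq (A i0) (B i0) 1 0; rewrite -hAB mulfV ?(chart_neq0 hV) //.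
  by rewrite rmorph1 rmorph0 mul0r addr0 hornerE horner0 mul0r addr0; apply.
have rel (F : {mpoly k[(pdim V).+1]}) : exists A1 B1,
    mmap (cst V) (fun i => gpt (p := V) i / gpt i0) F = ev A1 + ev B1 * y /\
    F.@[w] = A1.[a] + B1.[a] * b.
  apply: (@mmap_rel _ _ _ _ (cst V) idfun _ w (fun u v => exists A1 B1,
    u = ev A1 + ev B1 * y /\ v = A1.[a] + B1.[a] * b)) => [e|||i].
  - by exists e%:P, 0; rewrite evC hornerC rmorph0 horner0 !mul0r !addr0.
  - move=> _ _ _ _ [A1 [B1 [-> ->]]] [A2 [B2 [-> ->]]].
    by exists (A1 + A2), (B1 + B2); rewrite !rmorphD !hornerD /=; split; ring.
  - move=> _ _ _ _ [A1 [B1 [-> ->]]] [A2 [B2 [-> ->]]].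
    exists (A1 * A2 + B1 * B2 * Q), (A1 * B2 + B1 * A2).
    rewrite !(rmorphD, rmorphM, hornerD, hornerM) /= -(quad_sqr q) -ab.
    by split; ring.
  by exists (A i), (B i).
have wP : on_variety (V := V) w.
  split; first by exists i0; rewrite w0 oner_neq0.
  move=> d F hF F0; have [A1 [B1 [E ->]]] := rel F.
  have := @mmap_scale _ _ _ (cst V) (gpt (p := V)) (gpt (p := V) i0)^-1 d F hF.
  rewrite F0 mulr0 => E0.
  have [|-> ->] := quad_indep q (A := A1) (B := B1).
    rewrite -E -E0; apply: (@mmap_rel _ _ _ _ _ _ _ _ (fun u v => u = v)) => //.
    - by move=> ? ? ? ? -> ->.
    - by move=> ? ? ? ? -> ->.
    by move=> i; rewrite mulrC.
  by rewrite !horner0 mul0r addr0.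
exists (Point wP); have p0 : Point wP i0 != 0 by rewrite /= w0 oner_neq0.
have [j xE] := chart_x hV; have [l yE] := chart_y hV.
split=> //.
- rewrite -{1}xE; have := has_value_coord j p0; rewrite /= w0 divr1.
  have -> // : w j = a.
  have := lin_uniq (A j) (B j) 'X 0.
  by rewrite -hAB xE evX rmorph0 hornerX horner0 !mul0r !addr0; apply.
rewrite -{1}yE; have := has_value_coord l p0; rewrite /= w0 divr1.
have -> // : w l = b.
have := lin_uniq (A l) (B l) 0 1.
rewrite -hAB yE rmorph1 rmorph0 !hornerE.
by rewrite ?mul1r ?add0r; apply.
Qed.

Section Regular.
Variables (p : point V) (p0 : p i0 != 0).

Lemma chart_regular_ev P : regular_at p (ev P).
Proof.
by have [a [b [xa _]]] := chart_values p0; exists P.[a]; exact: has_value_ev.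
Qed.

Lemma chart_regular_y : regular_at p y.
Proof. by have [a [b [_ yb]]] := chart_values p0; exists b. Qed.

Lemma quad_der_div f g : g != 0 ->
  D (f / g) = (g * D f - f * D g) / g ^+ 2.
Proof.
move=> g0; have := quad_derM q two (f / g) g; rewrite divfK // => E.
apply: (mulIf (expf_neq0 2 g0)); rewrite divfK ?expf_neq0 // E.
rewrite -[X in _ - X * _](divfK g0); move: (f / g) => u; ring.
Qed.

(* y D is a derivation with y D x = y and y D y = Q'/2. *)
Lemma chart_der_regular z : regular_at p z -> regular_at p (y * D z).
Proof.
pose good u := regular_at p u /\ regular_at p (y * D u).
have good_ev P : good (ev P).
  split; first exact: chart_regular_ev.
  rewrite (quad_der_ev q).
  by apply: regularM; [exact: chart_regular_y | exact: chart_regular_ev].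
have goodD u v : good u -> good v -> good (u + v).
  move=> [u1 u2] [v1 v2]; split; first exact: regularD.
  by rewrite (quad_derD q) mulrDr; exact: regularD.
have goodM u v : good u -> good v -> good (u * v).
  move=> [u1 u2] [v1 v2]; split; first exact: regularM.
  rewrite (quad_derM q two) mulrDr !(mulrCA y).
  by apply: regularD; exact: regularM.
have good_y : good y.
  split; first exact: chart_regular_y.
  have -> : y * D y = cst V 2%:R^-1 * ev Q^`().
    rewrite -(quad_der_y q two) fmorphV rmorph_nat -mulrA mulKf //.
    exact: quad_two (cst V) two.
  by apply: regularM; [exact: regular_cst | exact: chart_regular_ev].
have good_F F : good (mmap (cst V) (fun i => gpt (p := V) i / gpt i0) F).
  apply: (@mmap_rel _ _ _ _ (cst V) (cst V) _ (fun i => gpt (p := V) i / gpt i0)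
    (fun u _ => good u)) => [a|u _ v _|u _ v _|i]; last 1 first.
  - by have [A [B ->]] := chart_lin hV i; apply: goodD => //; exact: goodM.
  - by rewrite -(evC _ x).
  - exact: goodD.
  - exact: goodM.
move=> [c [d [F [G [hF hG G0 -> _]]]]].
pose s := (gpt (p := V) i0)^-1.
have s0 : s != 0 by rewrite invr_eq0 (chart_neq0 hV).
have sE (H : {mpoly k[(pdim V).+1]}) : H \is d.-homog ->
    mmap (cst V) (fun i => gpt (p := V) i / gpt i0) H
      = s ^+ d * mmap (cst V) (gpt (p := V)) H.
  move=> hH; rewrite -mmap_scale //.
  apply: (@mmap_rel _ _ _ _ _ _ _ _ (fun u v => u = v)) => //.
  - by move=> ? ? ? ? -> ->.
  - by move=> ? ? ? ? -> ->.
  by move=> i; rewrite mulrC.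
have [f1 f2] := good_F F; have [g1 g2] := good_F G.
have gv : has_value p (mmap (cst V) (fun i => gpt (p := V) i / gpt i0) G)
    ((p i0)^-1 ^+ d * G.@[p]).
  have -> : (p i0)^-1 ^+ d * G.@[p] = G.@[fun i => p i / p i0].
    rewrite /meval -mmap_scale //.
    apply: (@mmap_rel _ _ _ _ _ _ _ _ (fun u v => u = v)) => //.
    - by move=> ? ? ? ? -> ->.
    - by move=> ? ? ? ? -> ->.
    by move=> i; rewrite mulrC.
  by apply: has_value_mmap => i; exact: has_value_coord.
have w0 : (p i0)^-1 ^+ d * G.@[p] != 0 by rewrite mulf_neq0 ?expf_neq0 ?invr_eq0.
have g0 := has_value_neq0 gv w0.
have -> : mmap (cst V) (gpt (p := V)) F / mmap (cst V) (gpt (p := V)) G =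
    mmap (cst V) (fun i => gpt (p := V) i / gpt i0) F /
    mmap (cst V) (fun i => gpt (p := V) i / gpt i0) G.
  by rewrite !sE // -mulf_div mulfV ?expf_neq0 // mul1r.
move: f1 f2 g1 g2 gv g0; move: (mmap _ _ F) (mmap _ _ G) => f g f1 f2 g1 g2 gv g0.
rewrite quad_der_div // mulrA mulrBr !(mulrCA y); apply: regularM.
  by apply: regularD; [|apply: regularN]; exact: regularM.
by eexists; apply: has_valueV; [exact: has_valueX gv | exact: expf_neq0].
Qed.

Lemma chart_der_regular_at f : der_regular_at p D f -> regular_at p (y * f).
Proof.
move=> [m [g [h [hg hh ->]]]]; rewrite mulr_sumr; apply: regular_sum => i.
by rewrite mulrCA; apply: regularM => //; exact: chart_der_regular.
Qed.

(** Where y is nonzero, R dx / y is visibly regular. Where y = 0, differentiating y^2 = Q(x) gives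
    dx / y = 2 dy / Q'(x), and Q' does not vanish at a simple root of Q. *)
Lemma chart_regular_form R : der_regular_at p D (ev R / y).
Proof.
have [a [b [xa yb]]] := chart_values p0; have y0 := quad_y_neq0 q.
have [b0|b0] := eqVneq b 0; last first.
  rewrite -[_ / y]mulr1 -(quad_der_x q); apply: der_regular_at1.
    apply: regularM; first exact: chart_regular_ev.
    by exists b^-1; exact: has_valueV.
  by exists a.
have Q'a : Q^`().[a] != 0.
  by apply: (quad_simple q); rewrite /root -(chart_point_eq q xa yb) b0 expr0n.
have Q'v := has_value_ev xa Q^`(); have Q'0 := has_value_neq0 Q'v Q'a.
have -> : ev R / y = 2%:R * ev R / ev Q^`() * D y.
  apply: (mulIf y0); rewrite divfK // -{1}[ev R](mulfK Q'0) -{1}(quad_der_y q two).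
  by move: (ev Q^`())^-1 (ev R) (D y) => e r d; ring.
apply: der_regular_at1; last exact: chart_regular_y.
apply: regularM; last by exists (Q^`().[a])^-1; exact: has_valueV.
apply: regularM; last exact: chart_regular_ev.
by rewrite -(rmorph_nat (cst V)); exact: regular_cst.
Qed.

End Regular.

(** Roots a of the denominator E are cancelled one at a time. With b^2 = Q(a), the numerator A + B y
    vanishes at the points (a, b) and (a, - b), so A(a) = 0, and B(a) = 0 as well when b is
    nonzero. *)
Lemma chart_integral z : (forall p : point V, p i0 != 0 -> regular_at p z) ->
  exists A B, z = ev A + ev B * y.
Proof.
move=> hz; have [A [B [E [E0 zE]]]] := quad_gen q z.
have [n] := ubnP (size E); elim: n A B E E0 zE => // n IH A B E E0 zE le.
have [/eqP/size_poly1P[e e0 EE]|/closed_rootP[a ra]] := eqVneq (size E) 1%N.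
  exists (e^-1 *: A), (e^-1 *: B); apply: (mulIf (x := cst V e)).
    by rewrite fmorph_eq0.
  rewrite -(evC _ x) -EE zE !evZ EE evC -mulrA -mulrDr mulrAC fmorphV mulVf ?mul1r //.
  by rewrite fmorph_eq0.
have /closed_rootP[b] : size ('X^2 - Q.[a]%:P) != 1%N.
  by rewrite size_XnsubC.
rewrite /root !hornerE subr_eq0 => /eqP ab.
have lin b' : b' ^+ 2 = Q.[a] -> A.[a] + B.[a] * b' = 0.
  move=> ab'; have [p [p0 xa yb]] := chart_point ab'.
  have [v hv] := hz p p0; have := has_value_lin xa yb A B; rewrite -zE => h.
  apply: (has_value_unique h); rewrite -[0](mulr0 v) -(eqP ra).
  by apply: has_valueM => //; exact: has_value_ev.
have [A1 AE] : exists A1, A = ('X - a%:P) * A1.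
  apply: root_factor; apply/eqP/(mulfI two); rewrite mulr0.
  transitivity ((A.[a] + B.[a] * b) + (A.[a] + B.[a] * - b)); first by ring.
  by rewrite !lin ?addr0 // sqrrN.
have [E1 EE] := root_factor ra.
have a0 := ev_XsubC_neq0 a q.
have [B1 BE] : exists B1, B = ('X - a%:P) * B1.
  apply: root_factor; apply/eqP.
  have A0 : A.[a] = 0 by rewrite AE hornerM hornerXsubC subrr mul0r.
  have [b0|b0] := eqVneq b 0; last first.
    by apply: (mulIf b0); have := lin b ab; rewrite A0 add0r mul0r.
  have [|T QE Ta] := @simple_root_factor _ Q a (quad_simple q).
    by rewrite /root -ab b0 expr0n.
  have [p [p0 xa yb]] := chart_point ab; rewrite b0 in yb.
  have [v hv] := hz p p0.
  (* At a branch point the relation is multiplied by y and divided by x - a, using y^2 = (x - a) T;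
     its value there is B(a) T(a) = 0. *)
  have E' : z * ev E1 * y = ev A1 * y + ev B * ev T.
    have yy : y * y = ev ('X - a%:P) * ev T.
      by rewrite -expr2 (quad_sqr q) {1}QE rmorphM.
    have zE' : z * (ev ('X - a%:P) * ev E1) = ev ('X - a%:P) * ev A1 + ev B * y.
      by rewrite -!rmorphM /= -EE zE AE.
    apply: (mulfI a0); rewrite -ev_XsubC.
    transitivity (z * (ev ('X - a%:P) * ev E1) * y); first by ring.
    rewrite zE' mulrDl -[ev B * y * y]mulrA yy; ring.
  have h : has_value p (ev A1 * y + ev B * ev T) (A1.[a] * 0 + B.[a] * T.[a]).
    by apply: has_valueD; apply: has_valueM => //; exact: has_value_ev.
  have h' : has_value p (z * ev E1 * y) (v * E1.[a] * 0).
    by apply: has_valueM => //; apply: has_valueM => //; exact: has_value_ev.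
  rewrite E' in h'; have := has_value_unique h h'.
  by rewrite !mulr0 add0r => /eqP; rewrite mulf_eq0 (negPf Ta) orbF => /eqP.
apply: (IH A1 B1 E1); last first.
- move: le; rewrite EE size_monicM ?monicXsubC ?size_XsubC //.
  by move: E0; rewrite EE mulf_eq0 negb_or => /andP[].
- apply: (mulfI a0); rewrite -ev_XsubC mulrCA -rmorphM /= -EE zE AE BE.
  by rewrite !rmorphM /=; ring.
by move: E0; rewrite EE mulf_eq0 negb_or => /andP[].
Qed.

End Chart.

(** * A smooth projective model of k(x, y) *)

Section Model.
Variables (k : closedFieldType) (K : fieldType) (c : {rmorphism k -> K}).
Variables (x y : K) (Q : {poly k}).
Hypothesis q : quadratic_field c x y Q.
Local Notation m := (size Q)./2.
Local Notation x' := (x^-1).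
Local Notation y' := (y / x ^+ m).

(* (1 : x : ... : x^m : y), whose last coordinate would be the y-axis of the   *)
(* weighted plane P(1, 1, m).                                                  *)
Definition model_gpt (i : 'I_m.+2) : K := if (i <= m)%N then x ^+ i else y.

Lemma model_gpt0 : model_gpt ord0 = 1.
Proof. by rewrite /model_gpt expr0. Qed.

Lemma model_gptE i : (i <= m)%N -> model_gpt (inord i) = x ^+ i.
Proof. by move=> le; rewrite /model_gpt inordK ?le // ltnW // !ltnS. Qed.

Lemma model_gpt_max : model_gpt ord_max = y.
Proof. by rewrite /model_gpt /= ltnn. Qed.

Lemma model_gpt_neq0 : exists i, model_gpt i != 0.
Proof. by exists ord0; rewrite model_gpt0 oner_neq0. Qed.

Lemma model_ffield_gen (z : K) : exists d (F G : {mpoly k[m.+2]}),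
  [/\ F \is d.-homog, G \is d.-homog, mmap c model_gpt G != 0
    & z = mmap c model_gpt F / mmap c model_gpt G].
Proof.
pose P u := ratio c c model_gpt model_gpt u u.
have Pc i : P (model_gpt i).
  rewrite -[model_gpt i]divr1 -model_gpt0.
  by apply: ratio_coord; rewrite model_gpt0 oner_neq0.
have Px : P x by have := Pc (inord 1); rewrite model_gptE ?(quad_m_gt0 q).
have Py : P y by rewrite -model_gpt_max.
have Pev A : P (ev c x A).
  apply: (@ev_ind _ _ c x (fun _ u => P u)) => // [a|A1 B1 u v|A1 B1 u v].
  - exact: ratio_cst.
  - exact: ratioD.
  - exact: ratioM.
have [A [B [E [E0 zE]]]] := quad_gen q z.
have e0 : ev c x E != 0 by rewrite (quad_ev_eq0 q).
have : P z.
  rewrite -[z](mulfK e0) zE; apply: ratioM; last exact: (ratioV (Pev E) e0 e0).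
  exact: (ratioD (Pev A) (ratioM (Pev B) Py)).
by move=> [d [F [G [[hF hG] G0 _ zE' _]]]]; exists d, F, G.
Qed.

Definition model : pvariety k := PVariety model_gpt_neq0 model_ffield_gen.

Lemma model_chart : @affine_chart k model x y ord0.
Proof.
split; rewrite /= ?model_gpt0 ?oner_neq0 //.
- move=> i; rewrite divr1 /= /model_gpt; case: ifP => _.
    by exists 'X^i, 0; rewrite rmorph0 mul0r addr0 rmorphXn /= evX.
  by exists 0, 1; rewrite rmorph0 rmorph1 mul1r add0r.
- by exists (inord 1); rewrite divr1 model_gptE ?(quad_m_gt0 q).
by exists ord_max; rewrite divr1 model_gpt_max.
Qed.

Lemma model_chart_inv : @affine_chart k model x' y' (inord m).
Proof.
have x0 := quad_x_neq0 q; have m0 := quad_m_gt0 q.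
split; rewrite /= ?model_gptE ?expf_neq0 //.
- move=> i; rewrite /= /model_gpt; case: ifP => [le|_].
    exists 'X^(m - i)%N, 0; rewrite rmorph0 mul0r addr0 rmorphXn /= evX exprVn.
    rewrite -{1}(subKn le) expfB_cond ?(negPf x0) ?leq_subr //.
    by rewrite [LHS]mulrAC mulfV ?mul1r // expf_neq0.
  by exists 0, 1; rewrite rmorph0 rmorph1 mul1r add0r.
- exists (inord m.-1); rewrite model_gptE ?leq_pred // -{2}(prednK m0) exprS.
  by rewrite invfM mulrA mulrAC mulfV ?mul1r // expf_neq0.
by exists ord_max; rewrite model_gpt_max.
Qed.

(** If coordinates 0 and m vanish, the relations X_j^m = X_0^(m - j) X_m^j kill the coordinates up
    to m. The last one is then killed by the quadratic form of y^2 = Q(x), in which x^j is written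
    as a product of two coordinates with indices the two halves of j. *)
Lemma model_points (p : point model) : p ord0 != 0 \/ p (inord m) != 0.
Proof.
have hX d (j : 'I_m.+2) : ('X_j : {mpoly k[m.+2]}) ^+ d \is d.-homog.
  rewrite -[d in d.-homog]mul1n; apply: dhomogMn.
  by rewrite dhomogX; apply/eqP; exact: mdeg1.
apply: NNPP => h.
have [p0 pm] : p ord0 = 0 /\ p (inord m) = 0.
  by split; apply/eqP/negPn/negP => h'; apply: h; [left | right].
have [[i pi0] hp] := pointP p; have m0 := quad_m_gt0 q.
have pj j : (j <= m)%N -> p (inord j) = 0.
  move=> le; have [->//|lt] := eqVneq j m.
  have := hp m ('X_(inord j) ^+ m - 'X_ord0 ^+ (m - j) * 'X_(inord m) ^+ j).
  rewrite !(rmorphB, rmorphM, rmorphXn) /= !mmapX !mmap1U !mevalXU.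
  rewrite model_gptE // model_gptE // model_gpt0 -!exprM mulnC expr1n mul1r subrr.
  have mj : (0 < m - j)%N by rewrite subn_gt0 ltn_neqAle lt.
  rewrite p0 [0 ^+ (m - j)]expr0n (gtn_eqF mj) mul0r subr0 => /(_ _ erefl)/eqP.
  rewrite expf_eq0 m0 /= => E; apply/eqP/E; apply: rpredB; first exact: hX.
  by have := dhomogM (hX (m - j)%N ord0) (hX j (inord m)); rewrite subnK.
have py : p ord_max = 0.
  pose F : {mpoly k[m.+2]} := 'X_ord_max ^+ 2 -
    \sum_(j < m.*2.+1) Q`_j *: ('X_(inord j./2) * 'X_(inord (uphalf j))).
  have hj (j : 'I_m.*2.+1) : (j./2 <= m)%N /\ (uphalf j <= m)%N.
    by have := ltn_ord j; lia.
  have hF : F \is 2.-homog.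
    apply: rpredB; first exact: hX.
    apply: rpred_sum => j _; apply: rpredZ.
    exact: (dhomogM (hX 1%N _) (hX 1%N _)).
  have F0 : mmap c model_gpt F = 0.
    rewrite rmorphB rmorph_sum rmorphXn /= mmapX mmap1U model_gpt_max (quad_sqr q).
    rewrite evE (horner_coef_wide _ (n := m.*2.+1)) ?size_map_poly ?quad_size_le //.
    apply/eqP; rewrite subr_eq0; apply/eqP/eq_bigr => j _; have [j1 j2] := hj j.
    rewrite mmapZ rmorphM /= !mmapX !mmap1U !model_gptE // -exprD coef_map.
    by congr (_ * x ^+ _); lia.
  have := hp 2%N F hF F0; rewrite rmorphB rmorph_sum rmorphXn /= mevalXU.
  rewrite [X in _ - X]big1 => [|j _].
    by rewrite subr0 => /eqP; rewrite expf_eq0 /= => /eqP.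
  by rewrite mevalZ rmorphM /= !mevalXU pj ?(hj j).1 // mul0r mulr0.
move: pi0; have [ile|ige] := leqP i m.
  by rewrite -(inord_val (i : 'I_m.+2)) pj ?eqxx.
have -> : i = ord_max.
  have lt : (i < m.+2)%N := ltn_ord i.
  by apply/val_inj/eqP; rewrite /= eqn_leq ige -ltnS lt.
by rewrite py eqxx.
Qed.

Lemma model_smooth (two : 2%:R != 0 :> k) (p : point model) : nonsingular_at p.
Proof.
case: (model_points p) => p0.
  exact: (@chart_nonsingular_at k model _ _ _ _ q two model_chart p p0).
have h := quadratic_inverse q.
exact: (@chart_nonsingular_at k model _ _ _ _ h two model_chart_inv p p0).
Qed.

End Model.

Lemma quad_one_dimensional (k : closedFieldType) (V : pvariety k)
    (x y : ffield V) (Q : {poly k}) :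
  quadratic_field (cst V) x y Q -> one_dimensional V.
Proof.
move=> q; exists x; split=> [P /rootP|z]; first exact: quad_inj q _.
have [A [B [E [E0 zE]]]] := quad_gen q z.
(* The norm of E Z - (A + B y) over k(x), with Z the variable. *)
exists (E ^+ 2 *: 'X^2 - (2%:R * A * E) *: 'X + (A ^+ 2 - B ^+ 2 * Q)%:P).
  apply/eqP => /(congr1 (fun P : {poly {poly k}} => P`_2)) /eqP.
  rewrite coefD coefB !coefZ coefXn coefX coefC /= mulr1 mulr0 subr0 addr0 coef0.
  by rewrite expf_eq0 (negPf E0).
pose h : {rmorphism {poly k} -> ffield V} := ev (cst V) x.
rewrite (eq_map_poly (g := h)) // rmorphD rmorphB /= !map_polyZ /=.
rewrite map_polyXn map_polyX map_polyC.
rewrite /root hornerD hornerD hornerN !hornerZ hornerXn hornerX hornerC.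
have -> : h (E ^+ 2) = h E ^+ 2 by rewrite rmorphXn.
have -> : h (2%:R * A * E) = 2%:R * h A * h E by rewrite !rmorphM /= rmorph_nat.
rewrite -[X in _ + X]/(h (A ^+ 2 - B ^+ 2 * Q)).
rewrite rmorphB rmorphXn rmorphM rmorphXn /= -(quad_sqr q).
apply/eqP; transitivity ((z * h E - h A) ^+ 2 - (h B * y) ^+ 2); first by ring.
by rewrite [z * h E]zE /= [ev _ _ A + _]addrC addrK subrr.
Qed.

Definition model_curve (k : closedFieldType) (K : fieldType) (c : {rmorphism k -> K})
    (x y : K) (Q : {poly k}) (q : quadratic_field c x y Q) (two : 2%:R != 0 :> k) :=
  Curve (@quad_one_dimensional k (model q) x y Q q) (@model_smooth k K c x y Q q two).

(** * Regular forms and the genus *)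

(** Pull-back of regular forms: g dh goes to psi g d(psi h), and [e] is the factor of the chain rule
    between [D] and [D']. *)
Lemma der_regular_at_map (k : closedFieldType) (V W : pvariety k)
    (psi : {rmorphism ffield W -> ffield V}) (p : point V) (p' : point W)
    (D : ffield V -> ffield V) (D' : ffield W -> ffield W) e f :
  (forall z c, has_value p' z c -> has_value p (psi z) c) ->
  (forall z, D (psi z) = e * psi (D' z)) ->
  der_regular_at p' D' f -> der_regular_at p D (e * psi f).
Proof.
move=> hp hD [m [g [h [hg hh ->]]]].
exists m, (psi \o g), (psi \o h); split=> [i|i|] /=.
- by have [c /hp hc] := hg i; exists c.
- by have [c /hp hc] := hh i; exists c.
rewrite rmorph_sum mulr_sumr; apply: eq_bigr => i _.
by rewrite rmorphM hD mulrCA.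
Qed.

Section ModelForms.
Variables (k : closedFieldType) (K : fieldType) (c : {rmorphism k -> K}).
Variables (x y : K) (Q : {poly k}).
Hypothesis q : quadratic_field c x y Q.
Hypothesis two : 2%:R != 0 :> k.
Local Notation m := (size Q)./2.
Local Notation D := (quad_der c x y Q).
Local Notation D' := (quad_der c x^-1 (y / x ^+ m) (revp m.*2 Q)).

Let x0 := quad_x_neq0 q.
Let y0 := quad_y_neq0 q.
Let q' := quadratic_inverse q.

Lemma quad_der_inv z : D z = - x ^- 2 * D' z.
Proof.
rewrite (quad_der_unique q' two (quad_derD q) (quad_derM q two) (quad_der_cst q)).
congr (_ * _); have := quad_derM q two x x^-1; rewrite mulfV //.
rewrite -(rmorph1 c) (quad_der_cst q) (quad_der_x q) mulr1 => E.
apply: (mulfI x0); rewrite mulrN expr2 invfM mulrA mulfV // mul1r.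
by apply/eqP; rewrite -addr_eq0 -E.
Qed.

Lemma quad_der_inv' z : D' z = - x ^+ 2 * D z.
Proof. by rewrite quad_der_inv mulrA mulrNN mulfV ?mul1r // expf_neq0. Qed.

(** With x' = 1/x and y' = y / x^m, the form R dx / y becomes - R' dx' / y', where R' is the
    reversal of R in degree m - 2; this is a polynomial in x' since deg R <= m - 2. *)
Lemma model_regular_form (R : {poly k}) (p : point (model q)) :
  (size R < m)%N -> der_regular_at p D (ev c x R / y).
Proof.
move=> sR; case: (model_points p) => p0.
  exact: (@chart_regular_form k (model q) _ _ _ _ q two (model_chart q) p p0).
(* For m = 1 only R = 0 occurs, and [m - 2] would be truncated; a nonzero R forces m >= 2. *)
have [->|R0] := eqVneq R 0.
  rewrite rmorph0 mul0r; exists 0%N, (fun=> 0), (fun=> 0).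
  by split; [case | case | rewrite big_ord0].
have R1 : (0 < size R)%N by rewrite size_poly_gt0.
have := @chart_regular_form k (model q) _ _ _ _ q' two (model_chart_inv q) p p0
  (- revp (m - 2) R).
have -> : ev c x R / y = - x ^- 2 * (ev c x^-1 (- revp (m - 2) R) / (y / x ^+ m)).
  rewrite rmorphN /= (ev_revpV q); last by lia.
  have -> : x ^+ m = x ^+ 2 * x ^+ (m - 2) by rewrite -exprD subnKC //; lia.
  have := expf_neq0 (m - 2) x0; move: (x ^+ (m - 2)) (ev c x R) => u r u0.
  by field; rewrite x0 u0 y0.
apply: (@der_regular_at_map _ (model q) (model q) idfun) => // z.
exact: quad_der_inv.
Qed.

(** Regularity on the two charts writes y f as A + B y with polynomials in x, and y' x^2 f likewise
    with polynomials in 1/x. Comparing degrees in x gives B = 0 and deg A <= m - 2. *)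
Lemma model_regular_formP f : (forall p : point (model q), der_regular_at p D f) ->
  exists2 R : {poly k}, (size R < m)%N & f = ev c x R / y.
Proof.
move=> hf.
have [A [B zAB]] : exists A B, y * f = ev c x A + ev c x B * y.
  apply: (@chart_integral k (model q) _ _ _ _ q two (model_chart q)) => p p0.
  exact: (@chart_der_regular_at k (model q) _ _ _ _ q two (model_chart q) p p0).
have [A' [B' zAB']] : exists A' B', y / x ^+ m * (- x ^+ 2 * f)
    = ev c x^-1 A' + ev c x^-1 B' * (y / x ^+ m).
  apply: (@chart_integral k (model q) _ _ _ _ q' two (model_chart_inv q)) => p p0.
  apply: (@chart_der_regular_at k (model q) _ _ _ _ q' two (model_chart_inv q) p p0).
  apply: (@der_regular_at_map _ (model q) (model q) idfun) (hf p) => // z.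
  exact: quad_der_inv'.
pose N := (size A' + size B')%N.
have sA' : (size A' <= N.+1)%N by rewrite leqW // leq_addr.
have sB' : (size B' <= N.+1)%N by rewrite leqW // leq_addl.
have [EA EB] : A * 'X^(N + 2) + 'X^m * revp N A' = 0 /\ B * 'X^(N + 2) + revp N B' = 0.
  apply: (quad_indep q); rewrite !rmorphD !rmorphM !rmorphXn /= !evX !ev_revp //.
  have -> : x ^+ (N + 2) = x ^+ N * x ^+ 2 by rewrite exprD.
  have xm : x ^+ m != 0 by rewrite expf_neq0.
  have /(congr1 (fun u => x ^+ m * x ^+ N * u)) := zAB'.
  have -> : x ^+ m * x ^+ N * (y / x ^+ m * (- x ^+ 2 * f)) =
      - (x ^+ N * x ^+ 2 * (y * f)) by field.
  have -> : x ^+ m * x ^+ N * (ev c x^-1 A' + ev c x^-1 B' * (y / x ^+ m)) =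
      x ^+ m * (x ^+ N * ev c x^-1 A') + x ^+ N * ev c x^-1 B' * y by field.
  by rewrite zAB => E; rewrite mulrDl addrACA -E; ring.
have B0 : B = 0.
  apply/eqP/negPn/negP => B0; have := size_revp N B'.
  rewrite -(addr0_eq EB) size_polyN size_mulXn //.
  by have := size_poly_gt0 B; rewrite B0; lia.
exists A; last by apply: (mulfI y0); rewrite zAB B0 rmorph0 mul0r addr0 mulrC divfK.
have [->|A0] := eqVneq A 0; first by rewrite size_poly0 (quad_m_gt0 q).
have A0' : revp N A' != 0.
  apply/eqP => E; move/eqP: EA; rewrite E mulr0 addr0 mulf_eq0 (negPf A0).
  by rewrite expf_eq0 polyX_eq0 andbF.
have := congr1 (fun P : {poly k} => size P) (addr0_eq EA).
rewrite size_polyN [_ * revp _ _]mulrC !size_mulXn // => E.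
have := size_revp N A'; move: E.
by move: (size (revp _ _)) (size A) ((size Q)./2) => a b m1; lia.
Qed.

End ModelForms.

Section CurveForms.
Variables (k : closedFieldType) (C : curve k) (x y : ffield C) (Q : {poly k}).
Hypothesis q : quadratic_field (cst C) x y Q.
Hypothesis two : 2%:R != 0 :> k.
Local Notation m := (size Q)./2.
Local Notation ev := (ev (cst C) x).
Local Notation D := (quad_der (cst C) x y Q).
Let M := model_curve q two.

(** C and the model share their function field and are both smooth, so the identity of that field
    induces morphisms both ways, along which regular forms are transported. *)
Lemma curve_regular_formP f : (forall p : point C, der_regular_at p D f) <->
  exists2 R : {poly k}, (size R < m)%N & f = ev R / y.
Proof.
split=> [hf|[R sR ->] p].
  apply: (@model_regular_formP _ _ _ _ _ _ q two) => p.
  have [phi phiE] := @morphism_of_embedding k M C idfun (fun c => erefl).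
  rewrite -[f]mul1r.
  apply: (@der_regular_at_map k M C idfun p (phi p) D D 1 f _ _ (hf _)) => [z c hz|z].
    by have := pullbackP hz; rewrite phiE.
  by rewrite mul1r.
have [phi phiE] := @morphism_of_embedding k C M idfun (fun c => erefl).
rewrite -[ev R / y]mul1r.
apply: (@der_regular_at_map k C M idfun p (phi p) D D 1) => [z c hz|z|].
- by have := pullbackP hz; rewrite phiE.
- by rewrite mul1r.
exact: model_regular_form.
Qed.

(** A [form] is an arbitrary function of derivations; only regularity at some point writes it as a
    sum of g dh. *)
Lemma curve_point : inhabited (point C).
Proof.
have [phi _] := @morphism_of_embedding k M C idfun (fun c => erefl).
have /closed_rootP[b] : size ('X^2 - Q.[0]%:P) != 1%N by rewrite size_XnsubC.
rewrite /root !hornerE subr_eq0 => /eqP b2.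
have [p _] := @chart_point k (model q) _ _ _ _ q (model_chart q) 0 b b2.
by exists; exact: (phi p).
Qed.

Definition quad_derivation : derivation C :=
  Derivation (quad_derD q) (quad_derM q two) (quad_der_cst q).

Lemma derivation_unique (D1 : derivation C) z : D1 z = D1 x * D z.
Proof.
by apply: (quad_der_unique q two); [exact: derD | exact: derM | exact: der_cst].
Qed.

Lemma regular_formP (w : Defs.form C) : regular_form w <->
  exists2 R : {poly k}, (size R < m)%N & forall D1, w D1 = D1 x * (ev R / y).
Proof.
split=> [hw|[R sR wE] p].
  have [p0] := curve_point.
  have wE D1 : w D1 = D1 x * w quad_derivation.
    have [n [g [h [_ _ E]]]] := hw p0; rewrite !E mulr_sumr.
    by apply: eq_bigr => i _; rewrite derivation_unique mulrCA.
  have /curve_regular_formP[R sR E] : forall p : point C,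
      der_regular_at p D (w quad_derivation).
    by move=> p; have [n [g [h [hg hh E]]]] := hw p; exists n, g, h.
  by exists R => // D1; rewrite wE E.
have /curve_regular_formP/(_ p)[n [g [h [hg hh E]]]] :
    exists2 R1 : {poly k}, (size R1 < m)%N & ev R / y = ev R1 / y by exists R.
exists n, g, h; split=> // D1; rewrite wE E mulr_sumr.
by apply: eq_bigr => i _; rewrite [D1 (h i)]derivation_unique mulrCA.
Qed.

Let comb n (R : 'I_n -> {poly k}) (a : 'rV[k]_n) :
  \sum_i cst C (a 0 i) * (ev (R i) / y) = ev (\sum_i a 0 i *: R i) / y.
Proof.
rewrite rmorph_sum mulr_suml; apply: eq_bigr => i _.
by rewrite mulrA -evZ.
Qed.

Let ev_y_inj A B : ev A / y = ev B / y -> A = B.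
Proof.
have y0 := quad_y_neq0 q.
by move/(mulIf (invr_neq0 y0))/(quad_ev_inj q).
Qed.

Lemma quad_genus : has_genus C (m.-1)%:Z.
Proof.
have m0 := quad_m_gt0 q.
exists m.-1, (fun i D1 => D1 x * (ev 'X^i / y)); split=> // [i|v].
  by apply/regular_formP; exists 'X^i => //; rewrite size_polyXn -ltn_predRL.
case/regular_formP=> R sR vE.
have sumE (a : 'rV[k]_m.-1) (D1 : derivation C) :
    \sum_i cst C (a 0 i) * (D1 x * (ev 'X^i / y)) = D1 x * (ev (rVpoly a) / y).
  under eq_bigr do rewrite mulrCA.
  rewrite -mulr_sumr (comb (fun i => 'X^i)) /rVpoly poly_def.
  by congr (_ * (ev _ / y)); apply: eq_bigr => i _; rewrite valK.
exists (poly_rV R); split=> [D1|a vaE].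
  by rewrite sumE poly_rV_K // -ltnS prednK.
have := vaE quad_derivation; rewrite vE sumE /= (quad_der_x q) !mul1r.
by move/ev_y_inj->; rewrite rVpolyK.
Qed.

(** The matrix expressing any other basis of regular forms through the x^i dx / y is row free by
    uniqueness of coordinates and row full by their existence, hence square. *)
Lemma quad_genus_unique h : has_genus C h -> h = (m.-1)%:Z.
Proof.
have m0 := quad_m_gt0 q.
move=> [n [w [-> hw ww]]]; congr Posz.
have hR i : exists R : {poly k}, (size R < m)%N /\
    forall D1, w i D1 = D1 x * (ev R / y).
  by have [R] := (regular_formP (w i)).1 (hw i); exists R.
have {hR}[R hR] := fin_all_exists hR.
pose A : 'M[k]_(n, m.-1) := \matrix_i poly_rV (R i).
have AE a : rVpoly (a *m A) = \sum_i a 0 i *: R i.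
  rewrite mulmx_sum_row raddf_sum; apply: eq_bigr => i _ /=.
  by rewrite rowK linearZ /= poly_rV_K // -ltnS prednK // (hR i).1.
have sumE (a : 'rV[k]_n) (D1 : derivation C) :
    \sum_i cst C (a 0 i) * w i D1 = D1 x * (ev (rVpoly (a *m A)) / y).
  rewrite AE -comb mulr_sumr; apply: eq_bigr => i _.
  by rewrite (hR i).2 mulrCA.
have form_of (v : 'rV[k]_m.-1) := ww (fun D1 => D1 x * (ev (rVpoly v) / y)).
have regv (v : 'rV[k]_m.-1) :
    regular_form (fun D1 : derivation C => D1 x * (ev (rVpoly v) / y)).
  apply/regular_formP; exists (rVpoly v) => //.
  by rewrite -[X in (_ < X)%N](prednK m0) ltnS size_poly.
have free : row_free A.
  apply: inj_row_free => a a0; have [b [_ hb]] := form_of 0 (regv 0).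
  rewrite -(hb a) ?(hb 0) // => D1; rewrite sumE ?a0 //.
  by rewrite mul0mx.
have full : row_full A.
  rewrite -sub1mx; apply/row_subP => i; move: (row i _) => v.
  have [a [/(_ quad_derivation) ha _]] := form_of v (regv v).
  move: ha; rewrite sumE /= (quad_der_x q) !mul1r => /ev_y_inj/(can_inj rVpolyK)->.
  exact: submxMl.
by rewrite -(eqP free) (eqP full).
Qed.

End CurveForms.

(** * Involutions *)

Lemma rmorphism_ex (K L : nzRingType) (f : K -> L) :
  (forall u v, f (u + v) = f u + f v) -> (forall u v, f (u * v) = f u * f v) ->
  f 1 = 1 -> exists s : {rmorphism K -> L}, forall u, s u = f u.
Proof.
move=> fD fM f1.
have f0 : f 0 = 0 by apply: (addrI (f 0)); rewrite -fD !addr0.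
have fB : zmod_morphism f.
  move=> u v; apply: (addIr (f v)).
  by rewrite -fD !subrK.
have fX : monoid_morphism f by split.
pose g : {rmorphism K -> L} :=
  HB.pack f (GRing.isZmodMorphism.Build K L f fB)
    (GRing.isMonoidMorphism.Build K L f fX).
by exists g.
Qed.

Section DegreeTwo.
Variables (F K : fieldType) (psi : {rmorphism F -> K}).
Hypothesis two : 2%:R != 0 :> K.

(** One basis vector is exchanged for 1; completing the square, with 2 invertible, makes the square
    of the other lie in F. *)
Lemma degree2_generator :
  (exists b : 'I_2 -> K, forall z, exists! a : 'rV[F]_2,
     z = \sum_i psi (a 0 i) * b i) ->
  exists z d, [/\ z ^+ 2 = psi d, forall w, exists a b, w = psi a + psi b * z
    & forall a b, psi a + psi b * z = 0 -> a = 0 /\ b = 0].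
Proof.
move=> [b hb].
have two' : 2%:R != 0 :> F by rewrite -(fmorph_eq0 psi) rmorph_nat.
have wlog_ab (e f : K) (a0 b0 : F) : a0 != 0 -> 1 = psi a0 * e + psi b0 * f ->
    (forall w, exists a b, w = psi a * e + psi b * f) ->
    (forall a b, psi a * e + psi b * f = 0 -> a = 0 /\ b = 0) ->
    exists z d, [/\ z ^+ 2 = psi d, forall w, exists a b, w = psi a + psi b * z
    & forall a b, psi a + psi b * z = 0 -> a = 0 /\ b = 0].
  move=> a0n E gen indep.
  have pa0 : psi a0 != 0 by rewrite fmorph_eq0.
  have eE : e = psi a0^-1 * (1 - psi b0 * f).
    by rewrite E addrK fmorphV mulKf.
  have gen' w : exists a b, w = psi a + psi b * f.
    have [a [b1 ->]] := gen w; exists (a * a0^-1), (b1 - a * a0^-1 * b0).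
    by rewrite eE rmorphB !rmorphM /=; ring.
  have indep' a b1 : psi a + psi b1 * f = 0 -> a = 0 /\ b1 = 0.
    move=> h; have [|aa bb] := indep (a * a0) (a * b0 + b1).
      rewrite rmorphD !rmorphM /=.
      transitivity (psi a * (psi a0 * e + psi b0 * f) + psi b1 * f); first by ring.
      by rewrite -E mulr1.
    have a_0 : a = 0 by apply/eqP; move/eqP: aa; rewrite mulf_eq0 (negPf a0n) orbF.
    by split=> //; rewrite a_0 mul0r add0r in bb.
  have [u [v uv]] := gen' (f ^+ 2).
  exists (f - psi (v / 2%:R)), (u + (v / 2%:R) ^+ 2).
  have vE : psi v = psi (v / 2%:R) + psi (v / 2%:R).
    by rewrite -rmorphD -mulrDl -mulr2n -[v *+ 2]mulr_natr mulfK.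
  split=> [|w|a b1].
  - by rewrite sqrrB uv rmorphD rmorphXn /= vE; ring.
  - have [a [b1 ->]] := gen' w; exists (a + b1 * (v / 2%:R)), b1.
    by rewrite rmorphD rmorphM /=; ring.
  move=> h; have [|aa b10] := indep' (a - b1 * (v / 2%:R)) b1.
    by rewrite rmorphB rmorphM /= -h; ring.
  by split=> //; move: aa; rewrite b10 mul0r subr0.
have sum2 (a : 'rV[F]_2) :
    \sum_i psi (a 0 i) * b i = psi (a 0 0) * b 0 + psi (a 0 1) * b 1.
  rewrite !big_ord_recl big_ord0 addr0.
  by congr (_ + psi (a 0 _) * b _); apply: val_inj.
pose row2 u v : 'rV[F]_2 := \row_i if i == 0 then u else v.
have row2E u v : \sum_i psi (row2 u v 0 i) * b i = psi u * b 0 + psi v * b 1.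
  by rewrite sum2 !mxE.
have gen w : exists u v, w = psi u * b 0 + psi v * b 1.
  by have [a [-> _]] := hb w; exists (a 0 0), (a 0 1).
have indep u v : psi u * b 0 + psi v * b 1 = 0 -> u = 0 /\ v = 0.
  move=> E; have [a [_ ha]] := hb 0.
  have h0 := ha (row2 0 0); have h1 := ha (row2 u v).
  rewrite !row2E E !rmorph0 !mul0r addr0 in h0 h1.
  have := h0 erefl; rewrite (h1 erefl) => /rowP h.
  by have := h 0; have := h 1; rewrite !mxE.
have [a0 [b0 E]] := gen 1.
have [a00|a00] := eqVneq a0 0; last exact: wlog_ab a00 E gen indep.
have b00 : b0 != 0.
  apply/eqP => b00; move/eqP: E.
  by rewrite a00 b00 !rmorph0 !mul0r addr0 oner_eq0.
rewrite addrC in E; apply: (wlog_ab _ _ _ _ b00 E) => [w|u v].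
  by have [u [v ->]] := gen w; exists v, u; rewrite addrC.
by rewrite addrC => /indep[].
Qed.

(** The conjugation a + b z -> a - b z. A fixed element has 2 b z = 0, so the fixed field is the
    image of F. *)
Lemma quadratic_involution z d :
  z ^+ 2 = psi d -> (forall w, exists a b, w = psi a + psi b * z) ->
  (forall a b, psi a + psi b * z = 0 -> a = 0 /\ b = 0) ->
  exists s : {rmorphism K -> K},
    [/\ forall a, s (psi a) = psi a, s z = - z,
        forall w, s (s w) = w & forall w, s w = w -> exists a, w = psi a].
Proof.
move=> zd gen indep.
have uniq a b a' b' : psi a + psi b * z = psi a' + psi b' * z -> a = a' /\ b = b'.
  move=> E; have [|] := indep (a - a') (b - b').
    rewrite !rmorphB /= mulrBl addrACA -opprD E addrN //.
  by move=> /subr0_eq-> /subr0_eq->.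
have gen2 w : exists ab, w = psi ab.1 + psi ab.2 * z.
  by have [a [b E]] := gen w; exists (a, b).
pose co w := proj1_sig (constructive_indefinite_description _ (gen2 w)).
have coP w : w = psi (co w).1 + psi (co w).2 * z.
  exact: proj2_sig (constructive_indefinite_description _ (gen2 w)).
pose f w := psi (co w).1 - psi (co w).2 * z.
have fE a b : f (psi a + psi b * z) = psi a - psi b * z.
  by rewrite /f; have [<- <-] := uniq _ _ _ _ (coP (psi a + psi b * z)).
have fpsi a : f (psi a) = psi a.
  by have := fE a 0; rewrite rmorph0 mul0r addr0 subr0.
have [u v|u v||s sE] := @rmorphism_ex K K f.
- rewrite (coP u) (coP v) addrACA -mulrDl -!rmorphD !fE !rmorphD /=; ring.
- rewrite (coP u) (coP v) !fE; move: (co u) (co v) => [a b] [a' b'] /=.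
  have -> : (psi a + psi b * z) * (psi a' + psi b' * z) =
      psi (a * a' + b * b' * d) + psi (a * b' + b * a') * z.
    by rewrite !rmorphD !rmorphM /= -zd; ring.
  by rewrite fE !rmorphD !rmorphM /= -zd; ring.
- by rewrite -(rmorph1 psi) fpsi.
have sz : s z = - z.
  by rewrite sE -{1}[z]add0r -{1}(rmorph0 psi) -{1}[z]mul1r -(rmorph1 psi) fE
    rmorph0 rmorph1 mul1r add0r.
have spsi a : s (psi a) = psi a by rewrite sE.
exists s; split=> // w; have [a [b ->]] := gen w.
  by rewrite !(rmorphD, rmorphM) /= !spsi !(rmorphN, rmorphM, sz, spsi) opprK.
rewrite rmorphD rmorphM /= !spsi sz mulrN => /addrI /eqP.
rewrite eq_sym -addr_eq0 -mulr2n -mulr_natl mulf_eq0 (negPf two) /= => /eqP->.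
by exists a; rewrite addr0.
Qed.

End DegreeTwo.

Lemma comp_polyX2_eq0 (k : closedFieldType) (P : {poly k}) :
  P \Po 'X^2 = 0 -> P = 0.
Proof.
move=> P0; apply/polyP => i; rewrite coef0.
have := congr1 (fun R : {poly k} => R`_(i * 2)) P0.
by rewrite coef_comp_poly_Xn // dvdn_mull // mulnK // coef0.
Qed.

(** E(x) E(- x) is the norm of E from k(x) to k(x^2); multiplying by E(- x) turns a denominator E
    into a polynomial in x^2. *)
Lemma even_poly_norm (k : closedFieldType) (E : {poly k}) : 2%:R != 0 :> k ->
  E * (E \Po (- 'X)) = even_poly (E * (E \Po (- 'X))) \Po 'X^2.
Proof.
move=> two; apply: even_poly_comp => //.
rewrite rmorphM /= -comp_polyA rmorphN /= comp_polyX opprK comp_polyXr.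
by rewrite mulrC.
Qed.

Lemma comp_polyNX_neq0 (k : closedFieldType) (E : {poly k}) :
  E != 0 -> E \Po (- 'X) != 0.
Proof.
apply: contraNneq => /(congr1 (fun P => P \Po (- 'X))).
by rewrite -comp_polyA rmorphN /= comp_polyX opprK comp_polyXr comp_poly0 => ->.
Qed.

(* k(t) is seen as quadratic over k(t^2), so that the genus formula covers it. *)
Lemma rational_quadratic_field (k : closedFieldType) (F : fieldType)
    (c : {rmorphism k -> F}) (t : F) : 2%:R != 0 :> k ->
  (forall P, ev c t P = 0 -> P = 0) ->
  (forall z, exists A E, E != 0 /\ z * ev c t E = ev c t A) ->
  quadratic_field c (t ^+ 2) t 'X.
Proof.
move=> two inj gen.
have evt P : ev c (t ^+ 2) P = ev c t (P \Po 'X^2).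
  by rewrite ev_comp rmorphXn /= evX.
split; rewrite ?evX ?size_polyX //.
- by move=> P; rewrite evt => /inj/comp_polyX2_eq0.
- by move=> a _; rewrite derivX /root hornerE oner_neq0.
move=> z; have [A [E [E0 zE]]] := gen z; pose G := E \Po (- 'X).
exists (even_poly (A * G)), (odd_poly (A * G)), (even_poly (E * G)); split.
  have : E * G != 0 by rewrite mulf_neq0 ?comp_polyNX_neq0.
  by apply: contraNneq => e0; rewrite even_poly_norm // -/G e0 comp_poly0.
rewrite !evt -even_poly_norm // rmorphM /= mulrA zE -rmorphM /=.
by rewrite -[in LHS](poly_even_odd (A * G)) rmorphD rmorphM /= evX.
Qed.

Section Translation.
Variables (k : closedFieldType) (K : fieldType) (c : {rmorphism k -> K}).
Variables (x y : K) (Q : {poly k}).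
Hypothesis q : quadratic_field c x y Q.

Lemma quadratic_translation a :
  quadratic_field c (x - c a) y (Q \Po ('X + a%:P)).
Proof.
have evt P : ev c (x - c a) (P \Po ('X + a%:P)) = ev c x P.
  by rewrite ev_comp rmorphD /= evX evC subrK.
split.
- move=> P P0; rewrite -[P](comp_polyXaddC_K _ (- a)) polyCN.
  have -> : P \Po ('X - a%:P) = 0.
    apply: (quad_inj q); rewrite -evt -P0; congr ev.
    by rewrite -comp_polyA rmorphB /= comp_polyX comp_polyC addrK comp_polyXr.
  by rewrite comp_poly0.
- by rewrite evt (quad_sqr q).
- move=> b; rewrite deriv_comp derivD derivX derivC addr0 mulr1.
  rewrite !root_comp; exact: (quad_simple q).
- by rewrite size_comp_poly2 ?(quad_size q) // size_XaddC.
move=> z; have [A [B [E [E0 zE]]]] := quad_gen q z.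
exists (A \Po ('X + a%:P)), (B \Po ('X + a%:P)), (E \Po ('X + a%:P)).
by rewrite !evt comp_poly2_eq0 // size_XaddC.
Qed.

(** The hyperelliptic involution, obtained like [quad_der] from a relation on presentations z E = A
    + B y. *)
Lemma quad_conjugation : 2%:R != 0 :> k -> exists s : {rmorphism K -> K},
  [/\ forall a, s (c a) = c a, s x = x & s y = - y].
Proof.
move=> two.
pose R z w := exists A B E, [/\ E != 0, z * ev c x E = ev c x A + ev c x B * y
  & w * ev c x E = ev c x A - ev c x B * y].
have Runiq z w w' : R z w -> R z w' -> w = w'.
  move=> [A [B [E [E0 zE wE]]]] [A' [B' [E' [E0' zE' wE']]]].
  have [EA EB] : A * E' = A' * E /\ B * E' = B' * E.
    apply: (quad_uniq q); rewrite !rmorphM /= !(mulrAC _ (ev c x E')) -mulrDl -zE.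
    by rewrite !(mulrAC _ (ev c x E)) -mulrDl -zE' mulrAC.
  have e0 : ev c x E != 0 by rewrite (quad_ev_eq0 q).
  have e0' : ev c x E' != 0 by rewrite (quad_ev_eq0 q).
  apply: (mulIf (mulf_neq0 e0 e0')); rewrite mulrA wE.
  rewrite [ev c x E * _]mulrC mulrA wE' !mulrBl -!rmorphM /= EA.
  by rewrite [_ * y * _]mulrAC [_ * y * ev c x E]mulrAC -!rmorphM /= EB.
have Rex z : exists w, R z w.
  have [A [B [E [E0 zE]]]] := quad_gen q z.
  exists ((ev c x A - ev c x B * y) / ev c x E), A, B, E; split=> //.
  by rewrite divfK // (quad_ev_eq0 q).
pose f z := epsilon (inhabits 0) (R z).
have fP z : R z (f z) by exact: epsilon_spec (Rex z).
have fE z w : R z w -> f z = w by exact: Runiq.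
have fA A B : f (ev c x A + ev c x B * y) = ev c x A - ev c x B * y.
  by apply: fE; exists A, B, 1; rewrite oner_neq0 rmorph1 !mulr1.
have fx : f x = x.
  have := fA 'X 0; rewrite evX rmorph0 mul0r addr0 subr0 //.
have fy : f y = - y.
  by have := fA 0 1; rewrite rmorph0 rmorph1 mul1r add0r sub0r.
have fc a : f (c a) = c a.
  by have := fA a%:P 0; rewrite evC rmorph0 mul0r addr0 subr0.
have [u v|u v||s sE] := @rmorphism_ex K K f.
- have [A [B [E [E0 zE wE]]]] := fP u.
  have [A' [B' [E' [E0' zE' wE']]]] := fP v.
  apply: fE; exists (A * E' + A' * E), (B * E' + B' * E), (E * E').
  rewrite mulf_neq0 // !(rmorphD, rmorphM) /=; split=> //.
    transitivity (u * ev c x E * ev c x E' + v * ev c x E' * ev c x E); first by ring.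
    by rewrite zE zE'; ring.
  transitivity (f u * ev c x E * ev c x E' + f v * ev c x E' * ev c x E);
    first by ring.
  by rewrite wE wE'; ring.
- have [A [B [E [E0 zE wE]]]] := fP u.
  have [A' [B' [E' [E0' zE' wE']]]] := fP v.
  apply: fE; exists (A * A' + B * B' * Q), (A * B' + A' * B), (E * E').
  rewrite mulf_neq0 // !(rmorphD, rmorphM) /= -(quad_sqr q); split=> //.
    by rewrite mulrACA zE zE'; ring.
  by rewrite mulrACA wE wE'; ring.
- by have := fc 1; rewrite rmorph1.
by exists s; rewrite !sE; split=> // a; rewrite sE.
Qed.

End Translation.

(** K = k(x)(z) with z^2 = N / M. Writing N M = S^2 Q with Q squarefree, y = z M / S satisfies y^2 =
    Q. *)
Lemma P1_quadratic_field (k : closedFieldType) (C : curve k) :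
  2%:R != 0 :> k -> double_cover C (P1 k) ->
  exists x y Q, quadratic_field (cst C) x y Q.
Proof.
move=> two [phi hphi]; pose psi : {rmorphism ffield (P1 k) -> ffield C} := pullback phi.
have two' : 2%:R != 0 :> ffield C by rewrite -(rmorph_nat (cst C)) fmorph_eq0.
have [z [d [zd gen indep]]] := degree2_generator two' hphi.
pose fr := @FracField.tofrac {poly k}; pose x := psi (fr 'X).
have evE P : psi (fr P) = ev (cst C) x P.
  elim/poly_ind: P => [|P a IH]; first by rewrite /fr tofrac0 !rmorph0.
  rewrite /fr tofracD tofracM -/fr rmorphD rmorphM IH rmorphD rmorphM /= evX evC.
  by congr (_ + _); exact: (pullback_cst phi).
have ev0 P : (ev (cst C) x P == 0) = (P == 0).
  by rewrite -evE fmorph_eq0 tofrac_eq0.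
have [N [M [M0 dE]]] := fraction_polyP d.
have z0 : z != 0.
  apply/eqP => z0; have [|_ /eqP] := indep 0 1; last by rewrite oner_eq0.
  by rewrite z0 mulr0 rmorph0 addr0.
have M0' : ev (cst C) x M != 0 by rewrite ev0.
have zM : z ^+ 2 * ev (cst C) x M = ev (cst C) x N.
  by rewrite zd dE fmorph_div /= !evE divfK.
have N0 : N != 0 by rewrite -ev0 -zM mulf_neq0 ?expf_neq0.
have [S [Q [NM hQ]]] := squarefree_part (mulf_neq0 N0 M0).
have S0 : S != 0.
  apply/eqP => S0; move: (mulf_neq0 N0 M0).
  by rewrite NM S0 expr0n mul0r eqxx.
have S0' : ev (cst C) x S != 0 by rewrite ev0.
pose y := z * ev (cst C) x M / ev (cst C) x S.
have yE : y ^+ 2 = ev (cst C) x Q.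
  have NM' : ev (cst C) x N * ev (cst C) x M = ev (cst C) x S ^+ 2 * ev (cst C) x Q.
    by rewrite -rmorphXn -!rmorphM /= -NM.
  by apply: (mulfI (expf_neq0 2 S0')); rewrite -NM' -zM /y; field.
exists x, y, Q; split=> //.
- by move=> P /eqP; rewrite ev0 => /eqP.
(* For constant Q, y would be a constant, contradicting the independence of 1 and z over k(x). *)
- rewrite ltnNge; apply/negP => /size1_polyC Q1.
  have /closed_rootP[b] : size ('X^2 - (Q`_0)%:P) != 1%N by rewrite size_XnsubC.
  rewrite /root !hornerE subr_eq0 => /eqP b2.
  have : (y - cst C b) * (y + cst C b) = 0.
    by rewrite -subr_sqr yE Q1 evC -rmorphXn -b2 /= subrr.
  have notc a : y = cst C a -> False.
    move=> yc; have [|_] := indep (fr (- (a *: S))) (fr M).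
      rewrite !evE rmorphN /= evZ -yc /y divfK // [z * _]mulrC addrC subrr //.
    by move/eqP; rewrite tofrac_eq0 (negPf M0).
  move/eqP; rewrite mulf_eq0 subr_eq0 addr_eq0 -rmorphN.
  by case/orP => /eqP /notc.
move=> w; have [a [b ->]] := gen w.
have [A [E [E0 ->]]] := fraction_polyP a; have [B [G [G0 ->]]] := fraction_polyP b.
exists (A * G * M), (B * E * S), (E * G * M).
split; first by rewrite !mulf_neq0.
have E0' : ev (cst C) x E != 0 by rewrite ev0.
have G0' : ev (cst C) x G != 0 by rewrite ev0.
rewrite !fmorph_div /= !evE !rmorphM /= /y.
move: (ev _ x A) (ev _ x E) (ev _ x B) (ev _ x G) (ev _ x M) (ev _ x S)
  E0' G0' S0' => ra re rb rg rm rs re0 rg0 rs0.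
by field; rewrite re0 rg0 rs0.
Qed.

(** * The action of an involution on x and y *)

Lemma exponent_le a b d n : b.-1 = (a.-1 * (n - 2))%N ->
  (b <= d)%N -> (d < n)%N -> (2 < n)%N -> (a <= 2)%N.
Proof.
move=> E bd dn n2; rewrite leqNgt; apply/negP => a2.
have : (2 * (n - 2) <= b.-1)%N by rewrite E leq_mul2r; apply/orP; right; lia.
by clear E; lia.
Qed.

Section Automorphism.
Variables (k : closedFieldType) (C : curve k) (x y : ffield C) (Q : {poly k}).
Hypothesis q : quadratic_field (cst C) x y Q.
Hypothesis two : 2%:R != 0 :> k.
Variable s : {rmorphism ffield C -> ffield C}.
Hypotheses (s_cst : forall a, s (cst C a) = cst C a) (s_inv : forall z, s (s z) = z).
Local Notation m := (size Q)./2.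
Local Notation ev := (ev (cst C) x).
Local Notation D := (quad_der (cst C) x y Q).

(** Conjugating d/dx by [s] gives a derivation, hence a multiple of d/dx; this is the chain rule for
    [s]. *)
Lemma der_automorphism z : D (s z) = D (s x) * s (D z).
Proof.
have E w : s (D (s w)) = s (D (s x)) * D w.
  apply: (quad_der_unique q two (D := fun w => s (D (s w)))) => [a b|a b|a].
  - by rewrite rmorphD (quad_derD q) rmorphD.
  - by rewrite rmorphM (quad_derM q two) rmorphD !rmorphM /= !s_inv.
  - by rewrite s_cst (quad_der_cst q) rmorph0.
by rewrite -[LHS]s_inv E rmorphM /= s_inv.
Qed.

Lemma der_automorphism_neq0 : D (s x) != 0.
Proof.
apply/eqP => e0; have := der_automorphism (s x).
by rewrite e0 mul0r s_inv (quad_der_x q) => /eqP; rewrite oner_eq0.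
Qed.

(** [s] comes from a morphism C -> C, along which R dx / y pulls back to a regular form. *)
Lemma regular_form_automorphism (R : {poly k}) : (size R < m)%N ->
  exists2 S : {poly k}, (size S < m)%N & D (s x) * s (ev R / y) = ev S / y.
Proof.
move=> sR; apply/(curve_regular_formP q two) => p.
have [phi phiE] := @morphism_of_embedding k C C s s_cst.
apply: (@der_regular_at_map k C C s p (phi p) D D) => [z c hz|z|].
- by have := pullbackP hz; rewrite phiE.
- exact: der_automorphism.
have /(curve_regular_formP q two) h : exists2 S : {poly k}, (size S < m)%N &
  ev R / y = ev S / y by exists R.
exact: h.
Qed.

(* On the canonical model, whose function field is generated by the ratios of  *)
(* the regular forms x^i dx / y, s acts linearly. With s x = A/B, the image of *)
(* x^(m - 2) dx / y is regular only when B^(m - 2) divides a polynomial of     *)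
(* degree at most m - 2.                                                       *)
Lemma automorphism_moebius : (2 < m)%N -> exists A B,
  [/\ coprimep A B, (size A <= 2)%N, (size B <= 2)%N & s x * ev B = ev A].
Proof.
move=> m2; have y0 := quad_y_neq0 q; have e0 := der_automorphism_neq0.
have sx0 : s x != 0 by rewrite fmorph_eq0 (quad_x_neq0 q).
(* The ratio of s(dx / y) to dx / y. The images of the forms x^i dx / y show that (s x)^i g is a
   polynomial of degree at most m - 2 for i <= m - 2. *)
pose g := D (s x) / s y * y.
have g0 : g != 0 by rewrite !mulf_neq0 ?invr_eq0 ?fmorph_eq0.
have hS i : (i.+1 < m)%N -> exists2 S : {poly k}, (size S < m)%N
    & s x ^+ i * g = ev S.
  move=> lt; have [|S sS SE] := @regular_form_automorphism 'X^i.
    by rewrite size_polyXn.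
  exists S => //; apply: (mulIf (invr_neq0 y0)); rewrite -SE.
  by rewrite fmorph_div /= rmorphXn /= evX rmorphXn /g mulrA mulfK // mulrCA.
have [|S0 sS0 E0] := hS 0%N; first lia.
have [|S1 sS1 E1] := hS 1%N; first lia.
have [|Sn sSn En] := hS (m - 2)%N; first lia.
rewrite expr0 mul1r in E0; rewrite expr1 in E1.
have S00 : S0 != 0 by rewrite -(quad_ev_eq0 q) -E0.
have Sn0 : Sn != 0 by rewrite -(quad_ev_eq0 q) -En mulf_neq0 ?expf_neq0.
have S10 : S1 != 0 by rewrite -(quad_ev_eq0 q) -E1 mulf_neq0.
pose G := gcdp S1 S0; pose A := S1 %/ G; pose B := S0 %/ G.
have AE : S1 = A * G by rewrite divpK // dvdp_gcdl.
have BE : S0 = B * G by rewrite divpK // dvdp_gcdr.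
have [A0 G0] : A != 0 /\ G != 0 by apply/andP; rewrite -negb_or -mulf_eq0 -AE.
have B0 : B != 0 by move: S00; rewrite BE mulf_eq0 negb_or => /andP[].
have AB : coprimep A B by apply: coprimep_div_gcd; rewrite S00 orbT.
have sxE : s x * ev B = ev A.
  have G0' : ev G != 0 by rewrite (quad_ev_eq0 q).
  by apply: (mulIf G0'); rewrite -mulrA -!rmorphM /= -AE -BE -E0 E1.
(* By coprimality A^(m - 2) divides [Sn] and B^(m - 2) divides [S0], so A and B have degree at most
   1. *)
have SAB : Sn * B ^+ (m - 2) = S0 * A ^+ (m - 2).
  apply: (quad_ev_inj q); rewrite [LHS]rmorphM [RHS]rmorphM !rmorphXn /=.
  by rewrite -En -E0 -sxE exprMn mulrAC mulrC.
have deg (P R : {poly k}) : P != 0 -> R != 0 -> (size R < m)%N ->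
    P ^+ (m - 2) %| R -> (size P <= 2)%N.
  move=> P0 R0 sR /dvdp_leq => /(_ R0) le.
  have := size_exp P (m - 2); have := size_poly_gt0 (P ^+ (m - 2)).
  rewrite expf_neq0 //; have := size_poly_gt0 P; rewrite P0.
  move=> a0 b0 E; exact: exponent_le E le sR m2.
have AnBn : coprimep (A ^+ (m - 2)) (B ^+ (m - 2)).
  by rewrite coprimep_expl // coprimep_expr.
exists A, B; split=> //.
  by apply: (deg A Sn) => //; rewrite -(Gauss_dvdpl _ AnBn) SAB dvdp_mull.
rewrite coprimep_sym in AnBn.
by apply: (deg B S0) => //; rewrite -(Gauss_dvdpl _ AnBn) -SAB dvdp_mull.
Qed.

(* If s x = - x then s (dx / y) = - dx / s y is regular, so that               *)
(* y = - S(x) s y; applying s gives S(x) S(-x) = 1, and S is constant.         *)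
Lemma involution_y : (1 < m)%N -> s x = - x -> s y = y \/ s y = - y.
Proof.
move=> m1 sx; have y0 := quad_y_neq0 q.
have sy0 : s y != 0 by rewrite fmorph_eq0.
have [|S sS] := @regular_form_automorphism 1; first by rewrite size_poly1.
have -> : D (s x) = -1.
  have := quad_derD q x (- x); rewrite subrr -{1}(rmorph0 (cst C)).
  rewrite (quad_der_cst q) (quad_der_x q) -sx => /esym/eqP.
  by rewrite addrC addr_eq0 => /eqP.
rewrite rmorph1 mul1r fmorphV => E.
have yE : - y = ev S * s y.
  have -> : ev S = -1 / s y * y by rewrite E divfK.
  by rewrite mulrAC divfK // mulN1r.
have syE : - s y = ev (S \Po (- 'X)) * y.
  have := congr1 s yE; rewrite rmorphN rmorphM /= s_inv => ->.
  by rewrite (ev_rmorph s_cst) sx ev_comp rmorphN /= evX.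
have S1 : S * (S \Po (- 'X)) = 1.
  apply: (quad_ev_inj q); rewrite rmorph1 rmorphM /=; apply: (mulIf y0).
  by rewrite -mulrA -syE mulrN -yE opprK mul1r.
have /size_poly1P[a a0 SE] : size S == 1%N.
  have S0 : S != 0 by apply/eqP => S0; move/eqP: S1; rewrite S0 mul0r eq_sym oner_eq0.
  have := congr1 (fun P : {poly k} => size P) S1; rewrite size_poly1.
  have S0' : S \Po (- 'X) != 0 by exact: comp_polyNX_neq0.
  rewrite size_mul //; have := size_poly_gt0 (S \Po (- 'X)); rewrite S0'.
  have := size_poly_gt0 S; rewrite S0.
  by move: (size S) (size (S \Po (- 'X))) => a b; lia.
have aa : a ^+ 2 = 1.
  apply/polyC_inj; rewrite polyC1 -S1 SE comp_polyC -polyCM.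
  by rewrite expr2.
have : s y = - (cst C a * y).
  by apply: oppr_inj; rewrite syE SE comp_polyC evC opprK.
move/eqP: aa; rewrite sqrf_eq1 => /orP[] /eqP -> ->.
  by right; rewrite rmorph1 mul1r.
by left; rewrite rmorphN1 mulN1r opprK.
Qed.

End Automorphism.

(** * Normal form of an involution *)

Section NormalForm.
Variables (k : closedFieldType) (K : fieldType) (c : {rmorphism k -> K}).
Hypothesis two : 2%:R != 0 :> k.
Variable s : {rmorphism K -> K}.
Hypotheses (s_cst : forall a, s (c a) = c a) (s_inv : forall z, s (s z) = z).

(** Applying [s] twice gives r^2 = 1 and p + r p = 0. For r = 1 this means p = 0; for r = -1 the
    origin is moved to the fixed point p / 2. *)
Lemma affine_involution x y Q p r :
  quadratic_field c x y Q -> s x = c p + c r * x ->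
  exists x1 y1 Q1, quadratic_field c x1 y1 Q1 /\ (s x1 = x1 \/ s x1 = - x1).
Proof.
move=> q sx.
have /(quad_inj q) E : ev c x ((r * r - 1) *: 'X + (p + r * p)%:P) = 0.
  rewrite rmorphD /= evZ evX evC; have := s_inv x.
  rewrite sx rmorphD rmorphM /= !s_cst sx => E.
  rewrite rmorphB rmorphD !rmorphM rmorph1 /= mulrBl mul1r -{2}E; ring.
have := congr1 (fun P : {poly k} => P`_0) E.
rewrite coefD coefZ coefX coefC coef0 /= mulr0 add0r => p0.
have := congr1 (fun P : {poly k} => P`_1) E.
rewrite coefD coefZ coefX coefC coef0 /= mulr1 addr0 => /eqP.
rewrite subr_eq0 -expr2 sqrf_eq1 => /orP[] /eqP r1.
  exists x, y, Q; split=> //; left.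
  have -> : s x = c p + x by rewrite sx r1 rmorph1 mul1r.
  move/eqP: p0; rewrite r1 mul1r -mulr2n -mulr_natl mulf_eq0 (negPf two) /=.
  by move/eqP->; rewrite rmorph0 add0r.
exists (x - c (p / 2%:R)), y, (Q \Po ('X + (p / 2%:R)%:P)).
split; first exact: quadratic_translation.
right; rewrite rmorphB /= s_cst sx r1 rmorphN1.
have -> : c p = c (p / 2%:R) + c (p / 2%:R).
  by rewrite -rmorphD -mulrDl -mulr2n -[p *+ 2]mulr_natr mulfK.
by ring.
Qed.

(* A fixed point r of the Moebius transformation is moved to infinity, where   *)
(* it becomes affine.                                                          *)
Lemma moebius_involution x y Q A B :
  quadratic_field c x y Q -> coprimep A B -> (size A <= 2)%N -> (size B <= 2)%N ->
  s x * ev c x B = ev c x A ->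
  exists x1 y1 Q1, quadratic_field c x1 y1 Q1 /\ (s x1 = x1 \/ s x1 = - x1).
Proof.
move=> q AB sA sB sxE.
have lin (P : {poly k}) : (size P <= 2)%N -> P = P`_1 *: 'X + (P`_0)%:P.
  move=> sP; apply/polyP => i; rewrite coefD coefZ coefX coefC.
  case: i => [|[|i]] /=; rewrite ?mulr0 ?mulr1 ?add0r ?addr0 //.
  by rewrite nth_default // (leq_trans sP).
have AE := lin A sA; have BE := lin B sB.
have B0 : B != 0.
  apply/eqP => B0; move: sxE AB; rewrite B0 rmorph0 mulr0 => /esym/(quad_inj q)->.
  by rewrite coprimep0 -size_poly_eq1 size_poly0.
have evl P : ev c x (P`_1 *: 'X + (P`_0)%:P) = c P`_1 * x + c P`_0.
  by rewrite rmorphD /= evZ evX evC.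
have evA : ev c x A = c A`_1 * x + c A`_0 by rewrite {1}AE evl.
have evB : ev c x B = c B`_1 * x + c B`_0 by rewrite {1}BE evl.
have [g0|g0] := eqVneq B`_1 0.
  have b0 : c B`_0 != 0.
    by rewrite fmorph_eq0; apply: contraNneq B0 => b0; rewrite BE g0 b0 scale0r addr0.
  apply: (affine_involution (p := A`_0 / B`_0) (r := A`_1 / B`_0) q).
  apply: (mulIf b0); move: sxE; rewrite evA evB g0 rmorph0 mul0r add0r => ->.
  by rewrite !fmorph_div /=; field.
(* A fixed point of A / B is a root of X B - A, which has degree 2 here. *)
have [r rE] : exists r, r * (B`_1 * r + B`_0) = A`_1 * r + A`_0.
  have /closed_rootP[r] : size ('X * B - A) != 1%N.
    have sB2 : size B = 2.
      by apply/eqP; rewrite eqn_leq sB ltnNge; apply: contra g0 => sB1;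
        rewrite nth_default.
    by rewrite size_polyDl ?size_polyN mulrC size_mulX ?sB2.
  rewrite /root {1}AE {1}BE !hornerE subr_eq0 => /eqP E; exists r; exact: E.
(* A - r B vanishes at r, so it is [kap] times X - r; hence [s] is affine in 1 / (x - r). *)
set kap := A`_1 - r * B`_1.
have E1 : (s x - c r) * ev c x B = c kap * (x - c r).
  rewrite mulrBl sxE evA evB /kap.
  have -> : A`_0 = r * (B`_1 * r + B`_0) - A`_1 * r by rewrite rE; ring.
  by rewrite !(rmorphB, rmorphM, rmorphD) /=; ring.
have xr a : x - c a != 0.
  by rewrite -(evC c x) -{1}(evX c x) -rmorphB (quad_ev_eq0 q) polyXsubC_eq0.
have sxr : s x - c r != 0.
  by rewrite -(s_cst r) -rmorphB fmorph_eq0.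
have kap0 : c kap != 0.
  apply: contra_eq_neq E1 => ->; rewrite mul0r mulf_neq0 //.
  by rewrite (quad_ev_eq0 q).
have q1 := quadratic_inverse (quadratic_translation q r).
apply: (affine_involution (p := B`_1 / kap) (r := (B`_1 * r + B`_0) / kap) q1).
rewrite fmorphV rmorphB /= s_cst.
have -> : (s x - c r)^-1 = ev c x B / (c kap * (x - c r)).
  apply: (mulfI sxr); rewrite mulfV // mulrA E1 mulfV // mulf_neq0 //.
rewrite evB !fmorph_div [c (_ * r + _)]rmorphD [c (_ * r)]rmorphM /=.
by field; rewrite kap0 xr.
Qed.

Lemma even_quadratic_field x y Q :
  quadratic_field c x y Q -> s x = - x -> s y = y \/ s y = - y ->
  Q = even_poly Q \Po 'X^2.
Proof.
move=> q sx sy; apply: even_poly_comp => //; apply: (quad_ev_inj q).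
rewrite ev_comp rmorphN /= evX -sx -(ev_rmorph s_cst) -(quad_sqr q) rmorphXn /=.
by case: sy => ->; rewrite ?sqrrN.
Qed.

End NormalForm.

(** * Fixed fields and quotient curves *)

Section EvenPolynomial.
Variables (k : closedFieldType) (S : {poly k}).
Hypothesis two : 2%:R != 0 :> k.
Hypothesis hS : simple_roots (S \Po 'X^2).

(** A double root b^2 of S makes b a double root of S(x^2), and S(0) = 0 makes 0 one. *)
Lemma simple_roots_even : simple_roots S /\ S.[0] != 0.
Proof.
split=> [a ra|].
  have /closed_rootP[b] : size ('X^2 - a%:P) != 1%N by rewrite size_XnsubC.
  rewrite /root !hornerE subr_eq0 => /eqP b2.
  have /hS : root (S \Po 'X^2) b by rewrite root_comp hornerXn b2.
  apply: contra; rewrite deriv_comp /root hornerM horner_comp hornerXn b2.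
  by move/eqP->; rewrite mul0r.
apply/negP => /eqP S0.
have /hS : root (S \Po 'X^2) 0 by rewrite root_comp hornerXn expr0n /root S0.
by rewrite deriv_comp /root hornerM derivXn hornerMn hornerXn expr1 mul0rn mulr0 eqxx.
Qed.

Lemma size_even : (size (S \Po 'X^2)) = (2 * (size S).-1).+1.
Proof.
have S0 : S \Po 'X^2 != 0 := simple_roots_neq0 hS.
by rewrite -(prednK (n := size _)) ?size_poly_gt0 // size_comp_poly size_polyXn mulnC.
Qed.

Lemma simple_roots_mulX : simple_roots ('X * S).
Proof.
have [S1 S0] := simple_roots_even.
move=> a; rewrite derivM derivX mul1r /root !hornerE mulf_eq0.
have [->|a0 /= Sa] := eqVneq a 0; first by rewrite mul0r addr0.
by rewrite (eqP Sa) add0r mulf_neq0 //; exact: S1.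
Qed.

End EvenPolynomial.

(* Here w stands for whichever of y and x y the involution fixes.              *)
Lemma fixed_quadratic_field (k : closedFieldType) (F K : fieldType)
    (cF : {rmorphism k -> F}) (c : {rmorphism k -> K})
    (psi : {rmorphism F -> K}) (r : {rmorphism K -> K}) (x w : K) (S : {poly k}) :
  2%:R != 0 :> k -> (forall a, psi (cF a) = c a) -> (forall a, r (c a) = c a) ->
  (forall z : K, r z = z -> exists a : F, z = psi a) ->
  (forall a : F, r (psi a) = psi a) ->
  r x = - x -> r w = w -> (forall P, ev c x P = 0 -> P = 0) ->
  (forall A B, ev c x A + ev c x B * w = 0 -> A = 0 /\ B = 0) ->
  (forall z, exists A B E, E != 0 /\ z * ev c x E = ev c x A + ev c x B * w) ->
  w ^+ 2 = ev c x (S \Po 'X^2) -> simple_roots S -> (1 < size S)%N ->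
  exists u v, quadratic_field cF u v S.
Proof.
move=> two psic rc rfix rpsi rx rw inj indep gen wE hS sS.
have [|u uE] := rfix (x ^+ 2); first by rewrite rmorphXn /= rx sqrrN.
have [v vE] := rfix w rw.
have evu P : psi (ev cF u P) = ev c x (P \Po 'X^2).
  by rewrite (ev_rmorph psic) -uE ev_comp rmorphXn /= evX.
exists u, v; split=> //.
- move=> P P0; apply/comp_polyX2_eq0/inj.
  by rewrite -evu P0 rmorph0.
- by apply: (fmorph_inj psi); rewrite rmorphXn /= -vE wE evu.
move=> z; have [A [B [E [E0 zE]]]] := gen (psi z).
(* Multiplying by E(- x) makes the denominator even; applying [r] then shows that both numerators
   are even too. *)
pose G := E \Po (- 'X).
have rev P : r (ev c x P) = ev c x (P \Po (- 'X)).
  by rewrite (ev_rmorph rc) rx ev_comp rmorphN /= evX.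
have zEG : psi z * ev c x (E * G) = ev c x (A * G) + ev c x (B * G) * w.
  by rewrite !rmorphM /= mulrA zE; ring.
have EG := even_poly_norm E two; rewrite -/G in EG.
have h : (A * G) \Po (- 'X) = A * G /\ (B * G) \Po (- 'X) = B * G.
  have /(congr1 r) := zEG; rewrite rmorphD rmorphM [X in _ = _ + X]rmorphM /=.
  rewrite rpsi rw !rev.
  have -> : (E * G) \Po (- 'X) = E * G.
    by rewrite EG -comp_polyA rmorphXn /= comp_polyX sqrrN.
  rewrite zEG => /eqP; rewrite -subr_eq0 opprD addrACA -mulrBl -!rmorphB /=.
  by move=> /eqP/indep[/subr0_eq<- /subr0_eq<-].
exists (even_poly (A * G)), (even_poly (B * G)), (even_poly (E * G)); split.
  have : E * G != 0 by rewrite mulf_neq0 ?comp_polyNX_neq0.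
  by apply: contraNneq => e0; rewrite EG e0 comp_poly0.
apply: (fmorph_inj psi); rewrite rmorphD !rmorphM /= !evu -EG -vE.
by rewrite -!even_poly_comp ?h.1 ?h.2 // zEG.
Qed.

Section FixedField.
Variables (K : fieldType) (t : {rmorphism K -> K}).

Definition fixed_pred : {pred K} := [pred z | t z == z].

Lemma fixed_divring_closed : divring_closed fixed_pred.
Proof.
split=> [|u v|u v]; rewrite !inE ?rmorph1 //.
  by move=> /eqP hu /eqP hv; rewrite rmorphB /= hu hv.
by move=> /eqP hu /eqP hv; rewrite fmorph_div /= hu hv.
Qed.

HB.instance Definition _ :=
  GRing.isDivringClosed.Build K fixed_pred fixed_divring_closed.

Record fixed_field := FixedField { fixed_val : K; _ : fixed_val \in fixed_pred }.

HB.instance Definition _ := [isSub for fixed_val].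
HB.instance Definition _ := [Choice of fixed_field by <:].
HB.instance Definition _ := [SubChoice_isSubIntegralDomain of fixed_field by <:].
HB.instance Definition _ := [SubIntegralDomain_isSubField of fixed_field by <:].

Definition fixed_inj : {rmorphism fixed_field -> K} := (val : fixed_field -> K).

Lemma fixed_injP (a : fixed_field) : t (fixed_inj a) = fixed_inj a.
Proof. exact/eqP/(valP a). Qed.

Lemma fixed_lift z : t z = z -> exists a, z = fixed_inj a.
Proof. by move/eqP => h; exists (FixedField h). Qed.

Lemma fixed_cst (k : fieldType) (c : {rmorphism k -> K}) :
  (forall a, t (c a) = c a) ->
  exists c' : {rmorphism k -> fixed_field}, forall a, fixed_inj (c' a) = c a.
Proof.
move=> tc; have h a : c a \in fixed_pred by rewrite inE tc.
pose f a := FixedField (h a).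
have fE a : fixed_inj (f a) = c a by [].
have [u v|u v||s sE] := @rmorphism_ex k fixed_field f.
- by apply: (fmorph_inj fixed_inj); rewrite rmorphD !fE rmorphD.
- by apply: (fmorph_inj fixed_inj); rewrite rmorphM !fE rmorphM.
- by apply: (fmorph_inj fixed_inj); rewrite rmorph1 fE rmorph1.
by exists s => a; rewrite sE.
Qed.

(** 1 and x form a basis over the fixed field: z = (z + t z)/2 + ((z - t z)/(2 x)) x, both
    coefficients being fixed because t x = - x. This provides the degree of the cover. *)
Lemma fixed_basis (x : K) : 2%:R != 0 :> K -> x != 0 ->
  (forall z, t (t z) = z) -> t x = - x ->
  exists b : 'I_2 -> K, forall z, exists! a : 'rV[fixed_field]_2,
    z = \sum_i fixed_inj (a 0 i) * b i.
Proof.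
move=> two x0 tt tx; exists (fun i : 'I_2 => if i == 0 then 1 else x) => z.
have sumE (a : 'rV[fixed_field]_2) :
    \sum_i fixed_inj (a 0 i) * (if i == 0 then 1 else x) =
    fixed_inj (a 0 0) + fixed_inj (a 0 1) * x.
  rewrite !big_ord_recl big_ord0 addr0 /= mulr1.
  by congr (_ + fixed_inj (a 0 _) * _); apply: val_inj.
have [a aE] : exists a, (z + t z) / 2%:R = fixed_inj a.
  by apply: fixed_lift; rewrite fmorph_div rmorph_nat rmorphD /= tt addrC.
have [b bE] : exists b, (z - t z) / (2%:R * x) = fixed_inj b.
  apply: fixed_lift; rewrite fmorph_div rmorphM rmorph_nat rmorphB /= tt tx.
  by rewrite mulrN invrN mulrN -mulNr opprB.
exists (\row_i if i == 0 then a else b); split=> [|a'].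
  rewrite sumE !mxE [RHS](_ : _ = fixed_inj a + fixed_inj b * x) //.
  by rewrite -aE -bE; field; rewrite two x0.
have uniq p q : z = fixed_inj p + fixed_inj q * x -> p = a /\ q = b.
  move=> E; split; apply: (fmorph_inj fixed_inj).
    by rewrite -aE E rmorphD rmorphM !fixed_injP tx; field.
  by rewrite -bE E rmorphD rmorphM !fixed_injP tx; field; rewrite two x0.
rewrite sumE => /uniq[a0 a1]; apply/rowP => i; rewrite !mxE.
case: i => -[|[|//]] lt /=; rewrite -?a0 -?a1; congr (a' 0 _); exact: val_inj.
Qed.

End FixedField.

Lemma quad_rmorph_id (k : closedFieldType) (K : fieldType)
    (c : {rmorphism k -> K}) (x y : K) (Q : {poly k}) (f : {rmorphism K -> K}) :
  quadratic_field c x y Q -> (forall a, f (c a) = c a) -> f x = x -> f y = y ->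
  forall w, f w = w.
Proof.
move=> q fc fx fy w; have [A [B [E [E0 wE]]]] := quad_gen q w.
have fev P : f (ev c x P) = ev c x P by rewrite (ev_rmorph fc) fx.
have e0 : ev c x E != 0 by rewrite (quad_ev_eq0 q).
apply: (mulIf e0); rewrite wE -{1}(fev E) -rmorphM wE rmorphD rmorphM /=.
by rewrite !fev fy.
Qed.

Section InvolutionQuotient.
Variables (k : closedFieldType) (K F : fieldType).
Variables (c : {rmorphism k -> K}) (cF : {rmorphism k -> F}).
Variables (psi : {rmorphism F -> K}) (r : {rmorphism K -> K}).
Variables (x y : K) (Q : {poly k}).
Hypothesis two : 2%:R != 0 :> k.
Hypothesis q : quadratic_field c x y Q.
Hypotheses (psic : forall a, psi (cF a) = c a) (rc : forall a, r (c a) = c a).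
Hypotheses (rfix : forall z, r z = z -> exists a, z = psi a)
  (rpsi : forall a, r (psi a) = psi a).

(** The fixed field is k(x), because a fixed A + B y has B = 0. It is presented by the equation y^2
    = x, of genus 0. *)
Lemma rational_quotient : r x = x -> r y = - y ->
  exists u v, quadratic_field cF u v 'X.
Proof.
move=> rx ry; have [t tE] := rfix rx.
have evt P : psi (ev cF t P) = ev c x P by rewrite (ev_rmorph psic) -tE.
exists (t ^+ 2), t; apply: rational_quadratic_field => // [P P0|z].
  by apply: (quad_inj q); rewrite -evt P0 rmorph0.
have [A [B [E [E0 zE]]]] := quad_gen q (psi z).
exists A, E; split=> //; apply: (fmorph_inj psi); rewrite rmorphM /= !evt zE.
have rev P : r (ev c x P) = ev c x P by rewrite (ev_rmorph rc) rx.
have : ev c x A + ev c x B * y = ev c x A + ev c x (- B) * y.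
  have := congr1 r zE; rewrite rmorphD !rmorphM /= !rev rpsi ry zE => ->.
  by rewrite rmorphN mulrN mulNr.
move=> /(quad_uniq q)[_] /eqP; rewrite -addr_eq0 -mulr2n -scaler_nat scaler_eq0.
by rewrite (negPf two) => /eqP->; rewrite rmorph0 mul0r addr0.
Qed.

Hypothesis QE : Q = even_poly Q \Po 'X^2.
Local Notation S := (even_poly Q).

Let hS : simple_roots (S \Po 'X^2).
Proof. by rewrite -QE; exact: quad_simple q. Qed.

Lemma quad_size_even : size Q = (2 * (size S).-1).+1.
Proof. by rewrite {1}QE size_even. Qed.

Lemma quad_size_even_gt1 : (1 < size S)%N.
Proof. by have := quad_size q; rewrite quad_size_even; case: (size S) => [|[]]. Qed.

Lemma quotient_fixing_y : r x = - x -> r y = y ->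
  exists u v, quadratic_field cF u v S.
Proof.
move=> rx ry; apply: (fixed_quadratic_field two psic rc rfix rpsi rx ry).
- exact: quad_inj q.
- exact: quad_indep q.
- exact: quad_gen q.
- by rewrite -QE (quad_sqr q).
- by have [] := simple_roots_even hS.
exact: quad_size_even_gt1.
Qed.

Lemma quotient_fixing_xy : r x = - x -> r y = - y ->
  exists u v, quadratic_field cF u v ('X * S).
Proof.
move=> rx ry; have X0 : 'X != 0 :> {poly k} by rewrite polyX_eq0.
apply: (@fixed_quadratic_field _ _ _ _ _ psi r x (x * y)) => //.
- by rewrite rmorphM /= rx ry mulrNN.
- exact: quad_inj q.
- move=> A B E; have [|-> /eqP] := quad_indep q (A := A) (B := B * 'X).
    by rewrite rmorphM /= evX -mulrA.
  by rewrite mulf_eq0 (negPf X0) orbF => /eqP.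
- move=> z; have [A [B [E [E0 zE]]]] := quad_gen q z.
  (* Multiplying z E = A + B y by x turns y into x y. *)
  exists (A * 'X), B, (E * 'X); rewrite mulf_neq0 //; split=> //.
  by rewrite !rmorphM /= evX mulrA zE; ring.
- rewrite exprMn (quad_sqr q) {1}QE [in RHS]rmorphM /= comp_polyX rmorphM.
  by rewrite rmorphXn /= evX.
- exact: simple_roots_mulX.
by rewrite mulrC size_mulX ?ltnS ?size_poly_gt0 // -size_poly_gt0;
  have := quad_size_even_gt1; lia.
Qed.

End InvolutionQuotient.

(** * The complementary involution *)

Section Complementary.
Variables (k : closedFieldType) (C : curve k).
Hypothesis two : 2%:R != 0 :> k.
Local Notation K := (ffield C).

Lemma complementary_involution (pi h : int) :
  hyperelliptic C -> has_genus C pi -> 2 <= pi -> 1 <= h ->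
  has_involution_over_genus C h -> has_involution_over_genus C (pi - h).
Proof.
move=> [_ /(P1_quadratic_field two)[x0 [y0 [Q0 q0]]]] gC pi2 h1.
move=> [X [[phi hphi] gX]].
have two' : 2%:R != 0 :> K by rewrite -(rmorph_nat (cst C)) fmorph_eq0.
have [z [d [zd gen indep]]] := degree2_generator two' hphi.
have [s [spsi sz ss sfix]] := quadratic_involution two' zd gen indep.
have phic := pullback_cst phi.
have s_cst a : s (cst C a) = cst C a by rewrite -phic spsi.
have m0 : (2 < (size Q0)./2)%N by have := quad_genus_unique q0 two gC; lia.
have [A [B [AB sA sB sx0]]] := automorphism_moebius q0 two s_cst ss m0.
have [x [y [Q [q sx]]]] := moebius_involution two s_cst ss q0 AB sA sB sx0.
have piE := quad_genus_unique q two gC.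
have m1 : (1 < (size Q)./2)%N by lia.
case: sx => sx.
  (* Here [s] is the hyperelliptic involution: s y = y would make it the identity, against s z = -
     z. Its quotient has genus 0, which h >= 1 excludes. *)
  have sy : s y = - y.
    have : (s y) ^+ 2 == y ^+ 2.
      by rewrite -rmorphXn (quad_sqr q) (ev_rmorph s_cst) sx.
    rewrite eqf_sqr => /orP[] /eqP // sy.
    have := quad_rmorph_id q s_cst sx sy z; rewrite sz => /eqP.
    rewrite eq_sym -addr_eq0 -mulr2n -mulr_natl mulf_eq0 (negPf two') /= => /eqP z0.
    have [|_ /eqP] := indep 0 1; last by rewrite oner_eq0.
    by rewrite z0 mulr0 rmorph0 addr0.
  have [u [v qX]] := rational_quotient two q phic s_cst sfix spsi sx sy.
  by have := quad_genus_unique qX two gX; rewrite size_polyX; lia.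
have sy := involution_y q two s_cst ss m1 sx.
have QE := even_quadratic_field two s_cst q sx sy.
have [i [ic ix iy]] := quad_conjugation q two.
(* The complementary involution: it also sends x to - x, but acts on y with the opposite sign to
   [s]. *)
pose t : {rmorphism K -> K} := s \o i.
have tc a : t (cst C a) = cst C a by rewrite /= ic s_cst.
have tx : t x = - x by rewrite /= ix.
have ty : t y = - s y by rewrite /= iy rmorphN.
have tt w : t (t w) = w.
  apply: (quad_rmorph_id (f := t \o t) q) => [a||].
  - by rewrite -[LHS]/(t (t _)) !tc.
  - by rewrite -[LHS]/(t (t _)) tx rmorphN tx opprK.
  rewrite -[LHS]/(t (t _)) ty rmorphN.
  by case: sy => sy; rewrite sy ?rmorphN ty sy ?opprK.
have [cL cLE] := fixed_cst tc.
have [b hb] := fixed_basis two' (quad_x_neq0 q) tt tx.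
(* The new quotient is the smooth model of the fixed field of [t]; its inclusion in K has degree 2
   and induces the double cover. *)
suff [u [v [S [qL gE]]]] : exists u v S, quadratic_field cL u v S /\
    pi - h = ((size S)./2.-1)%:Z.
  exists (model_curve qL two); split; last first.
    by rewrite gE; exact: (@quad_genus k (model_curve qL two) u v S qL two).
  have [f fE] := @morphism_of_embedding k C (model_curve qL two) (fixed_inj t) cLE.
  by exists f, b; rewrite fE.
(* With n the size of S = [even_poly Q], pi = n - 2, while the quotients have genera n./2 - 1 and (n
   + 1)./2 - 1, whose sum is n - 2. *)
have sE := quad_size_even q QE; have s1 := quad_size_even_gt1 q QE.
have sX : size ('X * even_poly Q) = (size (even_poly Q)).+1.
  by rewrite mulrC size_mulX // -size_poly_gt0; lia.
case: sy => sy.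
  have [u [v qX]] := quotient_fixing_y two q phic s_cst sfix spsi QE sx sy.
  have ty' : t y = - y by rewrite ty sy.
  have [u' [v' qL]] := quotient_fixing_xy two q cLE tc (@fixed_lift _ t)
    (@fixed_injP _ t) QE tx ty'.
  exists u', v', ('X * even_poly Q); split=> //.
  have := quad_genus_unique qX two gX; rewrite piE sE sX.
  by move: (size _) s1 => n; lia.
have [u [v qX]] := quotient_fixing_xy two q phic s_cst sfix spsi QE sx sy.
have ty' : t y = y by rewrite ty sy opprK.
have [u' [v' qL]] := quotient_fixing_y two q cLE tc (@fixed_lift _ t)
  (@fixed_injP _ t) QE tx ty'.
exists u', v', (even_poly Q); split=> //.
have := quad_genus_unique qX two gX; rewrite piE sE sX.
by move: (size _) s1 => n; lia.
Qed.

End Complementary.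

Theorem corollary3p3 (k : closedFieldType) (char0 : [pchar k] =i pred0)
    (pi g : int) (hpi : 2 <= pi) (hg : 1 <= g) (hgpi : g != pi) :
  Ch k pi g = Ch k pi (pi - g).
Proof.
have two : 2%:R != 0 :> k by have /pcharf0P -> := char0.
apply: functional_extensionality => c; apply: propositional_extensionality.
split=> -[C [cE hC gC inv]]; exists C; split=> //.
  exact: complementary_involution gC hpi hg inv.
(* The genus of X is a dimension, so pi - g >= 0, and g != pi excludes 0. *)
have hg' : 1 <= pi - g by have [X [_ [m [_ [E _ _]]]]] := inv; lia.
have -> : g = pi - (pi - g) by lia.
exact: complementary_involution gC hpi hg' inv.
Qed.
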